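(* Fix a universal Martin-Löf test $\mathcal U$. Then every exactly $\mathcal U$-layerwise computable function $f$ satisfies $f\restriction\mathrm{MLR}\le_{\mathrm W}\mathsf{LAY}_{\mathcal U}$, and there is a function $g$ (indeed the characteristic function of a set $\mathcal B\subseteq 2^\omega$) with $g\restriction\mathrm{MLR}\le_{\mathrm W}\mathsf{LAY}_{\mathcal U}$ that is not exactly $\mathcal U$-layerwise computable. Hence the class of exactly $\mathcal U$-layerwise computable functions is strictly smaller than the class of functions whose restrictions to $\mathrm{MLR}$ are Weihrauch-reducible to $\mathsf{LAY}_{\mathcal U}$.
   Context: Cantor space $2^\omega$, Lebesgue measure $\lambda$. A Martin-Löf (ML) test is a sequence $(\mathcal V_i)_{i\in\omega}$ of open subsets of $2^\omega$ such that $\{\langle i,\sigma\rangle:[\sigma]\subseteq\mathcal V_i\}$ is c.e. and $\lambda(\mathcal V_i)\le 2^{-i}$; it is universal if $\bigcap_i\mathcal V'_i\subseteq\bigcap_i\mathcal V_i$ for every ML-test $\mathcal V'$. $\mathrm{MLR}$ is the set of Martin-Löf random sequences ($=2^\omega\setminus\bigcap_i\mathcal U_i$ for universal $\mathcal U$); for $X\in\mathrm{MLR}$, $\mathrm{rd}_{\mathcal U}(X)=\min\{i:X\notin\mathcal U_i\}$. Functions are defined on $2^\omega$ with values in $2^\omega$ or $\omega$ ($n$ coded by $\chi_{\{n\}}$). $f$ is exactly $\mathcal U$-layerwise computable if there is a Turing functional $\Phi$ with $\Phi(\langle X,\mathrm{rd}_{\mathcal U}(X)\rangle)=f(X)$ for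 all $X\in\mathrm{MLR}$. A representation of a set $X$ is a surjective partial map $\delta_X:\subseteq\omega^\omega\to X$. A realizer of a multi-valued partial $f:\subseteq X\rightrightarrows Y$ is a partial $\Gamma:\subseteq\omega^\omega\to\omega^\omega$ with $\delta_Y(\Gamma(p))\in f(\delta_X(p))$ for all $p\in\mathrm{dom}(f\circ\delta_X)$. $f\le_{\mathrm W} g$ if there are Turing functionals $\Phi,\Psi$ such that $p\mapsto\Psi(\langle p,\Gamma(\Phi(p))\rangle)$ realizes $f$ for every realizer $\Gamma$ of $g$. $\mathrm{MLR}$ and $2^\omega$ are represented by the identity, $\omega$ by $\chi_{\{n\}}\mapsto n$. $\mathsf{LAY}_{\mathcal U}\colon\mathrm{MLR}\rightrightarrows\omega$, $\mathsf{LAY}_{\mathcal U}(X)=\{i:X\notin\mathcal U_i\}$. *)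

(* Defs.v *)
From mathcomp Require Import all_boot.
Set Implicit Arguments. Unset Strict Implicit. Unset Printing Implicit Defensive.

Inductive code : Type :=
| CZero
| CSucc
| CProj (i : nat)
| COracle
| CComp (f : code) (gs : list code)
| CPrec (f g : code)
| CMu (f : code).

Inductive eval (O : nat -> nat) : code -> list nat -> nat -> Prop :=
| ev_zero v : eval O CZero v 0
| ev_succ x v : eval O CSucc (x :: v) x.+1
| ev_proj i v : eval O (CProj i) v (nth 0 v i)
| ev_oracle x v : eval O COracle (x :: v) (O x)
| ev_comp f gs v ys y :
    evals O gs v ys -> eval O f ys y -> eval O (CComp f gs) v y
| ev_prec0 f g v y : eval O f v y -> eval O (CPrec f g) (0 :: v) y
| ev_precS f g n v y z :
    eval O (CPrec f g) (n :: v) y -> eval O g (n :: y :: v) z ->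
    eval O (CPrec f g) (n.+1 :: v) z
| ev_mu f v n :
    eval O f (n :: v) 0 ->
    (forall m, m < n -> exists k, eval O f (m :: v) k.+1) ->
    eval O (CMu f) v n
with evals (O : nat -> nat) : list code -> list nat -> list nat -> Prop :=
| evs_nil v : evals O [::] v [::]
| evs_cons g gs v y ys :
    eval O g v y -> evals O gs v ys -> evals O (g :: gs) v (y :: ys).

(* Turing functional with index e : partial map omega^omega -> omega^omega.
   runs e p q  <->  Phi_e(p) is defined (total output) and equals q. *)
Definition runs (e : code) (p q : nat -> nat) : Prop :=
  forall n, eval p e [:: n] (q n).

Definition ce (A : nat -> Prop) : Prop :=
  exists e : code, forall n, A n <-> exists y, eval (fun _ => 0) e [:: n] y.

Definition cpair (i j : nat) : nat := (i + j) * (i + j).+1 %/ 2 + j.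
(* bijective base-2 coding of binary strings *)
Fixpoint code_str (s : seq bool) : nat :=
  match s with [::] => 0 | b :: s' => (code_str s').*2 + 1 + b end.

Definition bpair (p q : nat -> nat) : nat -> nat :=
  fun n => if odd n then q n./2 else p n./2.

Definition cantor := nat -> bool.

Definition cyl (s : seq bool) (X : cantor) : Prop :=
  forall k, k < size s -> X k = nth false s k.

Definition is_open (V : cantor -> Prop) : Prop :=
  forall X, V X -> exists n, forall Y, cyl (mkseq X n) Y -> V Y.

(* lambda(V) <= 2^-i, for V open.  For open V, lambda(V) is the supremum
   over n of #{sigma in 2^n : [sigma] subset V} / 2^n (inner regularity),
   so lambda(V) <= 2^-i iff every finite set of distinct length-n strings
   whose cylinders lie in V has at most 2^(n-i) elements. *)
Definition measure_le_pow2 (V : cantor -> Prop) (i : nat) : Prop :=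
  forall n (S : seq (seq bool)), uniq S -> all (fun s => size s == n) S ->
    (forall s, s \in S -> forall Y, cyl s Y -> V Y) ->
    size S * 2 ^ i <= 2 ^ n.

Definition ML_test (V : nat -> cantor -> Prop) : Prop :=
  [/\ forall i, is_open (V i),
      ce (fun m => exists i s, m = cpair i (code_str s) /\
                               forall Y, cyl s Y -> V i Y)
    & forall i, measure_le_pow2 (V i) i].

Definition universal_ML_test (U : nat -> cantor -> Prop) : Prop :=
  ML_test U /\
  forall V, ML_test V -> forall X, (forall i, V i X) -> forall i, U i X.

Definition MLR (U : nat -> cantor -> Prop) (X : cantor) : Prop :=
  ~ (forall i, U i X).

Definition is_rd (U : nat -> cantor -> Prop) (X : cantor) (i : nat) : Prop :=
  ~ U i X /\ forall j, j < i -> U j X.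

Definition bits (X : cantor) : nat -> nat := fun n => nat_of_bool (X n).
Definition chi (i : nat) : nat -> nat := fun n => nat_of_bool (n == i).

Definition rep_cantor (Y : cantor) (p : nat -> nat) : Prop :=
  forall n, p n = bits Y n.
Definition rep_nat (i : nat) (p : nat -> nat) : Prop :=
  forall n, p n = chi i n.
Definition rep_MLR (U : nat -> cantor -> Prop) (X : cantor) (p : nat -> nat)
  : Prop := MLR U X /\ forall n, p n = bits X n.

Definition exactly_layerwise_computable (Y : Type)
    (U : nat -> cantor -> Prop) (repY : Y -> (nat -> nat) -> Prop)
    (f : cantor -> Y) : Prop :=
  exists e : code, forall X i, MLR U X -> is_rd U X i ->
    exists q, runs e (bpair (bits X) (chi i)) q /\ repY (f X) q.

(* Multivalued partial maps F : A => B as relations; dom F = {a | exists b, F a b}.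
   Gamma : partial map omega^omega -> omega^omega as option-valued function. *)
Definition realizer (A B : Type) (F : A -> B -> Prop)
    (repA : A -> (nat -> nat) -> Prop) (repB : B -> (nat -> nat) -> Prop)
    (Gamma : (nat -> nat) -> option (nat -> nat)) : Prop :=
  forall p a, repA a p -> (exists b, F a b) ->
    exists q, Gamma p = Some q /\ exists b, repB b q /\ F a b.

Definition weihrauch_le (A B C D : Type)
    (F : A -> B -> Prop) (repA : A -> (nat -> nat) -> Prop)
    (repB : B -> (nat -> nat) -> Prop)
    (G : C -> D -> Prop) (repC : C -> (nat -> nat) -> Prop)
    (repD : D -> (nat -> nat) -> Prop) : Prop :=
  exists ePhi ePsi : code, forall Gamma, realizer G repC repD Gamma ->
    forall p a, repA a p -> (exists b, F a b) ->
      exists q1, runs ePhi p q1 /\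
      exists q2, Gamma q1 = Some q2 /\
      exists q3, runs ePsi (bpair p q2) q3 /\
      exists b, repB b q3 /\ F a b.

Definition restr_MLR (Y : Type) (U : nat -> cantor -> Prop) (f : cantor -> Y)
  : cantor -> Y -> Prop := fun X y => MLR U X /\ y = f X.

Definition LAY (U : nat -> cantor -> Prop) : cantor -> nat -> Prop :=
  fun X i => MLR U X /\ ~ U i X.

(* Main.v *)
Require Import Defs.
From mathcomp Require Import all_boot.
From mathcomp Require Import zify.
From Stdlib Require Import Classical ClassicalEpsilon FunctionalExtensionality.

(** A function that is the limit of uniformly computable approximations G X s changing only
    finitely often on every random X reduces to LAY. Indeed, let Y copy X, but whenever the
    approximation changes at stage s + 1 first insert zeros until Y has entered U_i for all
    i <= s + 1; this is possible because computable sequences are not random. For random X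
    there are finitely many insertions, so Y is random, and Y outside U_i implies that the
    approximation does not change after stage i, so that G X i is the limit. The layer rd X is
    such a limit, which gives the first claim.

    For the separation, let P be a closed set of positive measure on which rd takes a constant
    value k, and let W be a c.e. open set whose trace on P is dense in P but not all of P: for
    each string of length n, W contains the leftmost of its extensions of length 2n + c that
    meet P, and a large c keeps the measure of W on P small. Membership in W is a limit with at
    most one change, but it is discontinuous on P at every point of P outside W, whereas an
    exactly layerwise computable function is continuous on P. *)

(** * Oracle computations *)

(** By monotonicity the maximum of the finitely many witnesses works. It brings finitely many
    events, each visible from some stage or use bound on, to a common one. *)
Lemma bounded_collection (A : nat -> nat -> Prop) n :
  (forall m N N', N <= N' -> A m N -> A m N') ->
  (forall m, m < n -> exists N, A m N) -> exists N, forall m, m < n -> A m N.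
Proof.
move=> Amono; elim: n => [|n IHn] An; first by exists 0.
have [|N HN] := IHn; first by move=> m lt_mn; apply: An; apply: ltnW.
have [N' HN'] := An n (ltnSn n).
exists (maxn N N') => m; rewrite ltnS leq_eqVlt => /orP[/eqP ->|/HN].
  exact: Amono (leq_maxr _ _) HN'.
exact: Amono (leq_maxl _ _).
Qed.

Lemma least_nat (P : nat -> Prop) :
  (exists n, P n) -> exists n, P n /\ forall m, m < n -> ~ P m.
Proof.
move=> [n]; elim/ltn_ind: n => n IHn Pn.
have [[m [lt_mn Pm]]|noP] := classic (exists m, m < n /\ P m); first exact: IHn Pm.
by exists n; split=> // m lt_mn Pm; apply: noP; exists m.
Qed.

Section EvalInduction.

Variables (O : nat -> nat) (P : code -> list nat -> nat -> Prop).
Variable Q : list code -> list nat -> list nat -> Prop.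
Hypothesis Hzero : forall v, P CZero v 0.
Hypothesis Hsucc : forall x v, P CSucc (x :: v) x.+1.
Hypothesis Hproj : forall i v, P (CProj i) v (nth 0 v i).
Hypothesis Horacle : forall x v, P COracle (x :: v) (O x).
Hypothesis Hcomp : forall f gs v ys y,
  Q gs v ys -> P f ys y -> P (CComp f gs) v y.
Hypothesis Hprec0 : forall f g v y, P f v y -> P (CPrec f g) (0 :: v) y.
Hypothesis HprecS : forall f g n v y z,
  P (CPrec f g) (n :: v) y -> P g (n :: y :: v) z ->
  P (CPrec f g) (n.+1 :: v) z.
Hypothesis Hmu : forall f v n, P f (n :: v) 0 ->
  (forall m, m < n -> exists k, P f (m :: v) k.+1) -> P (CMu f) v n.
Hypothesis Hnil : forall v, Q [::] v [::].
Hypothesis Hcons : forall g gs v y ys,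
  P g v y -> Q gs v ys -> Q (g :: gs) v (y :: ys).

(* The automatic scheme gives no induction hypothesis under the existential of ev_mu. *)
Fixpoint eval_nested_ind e v y (H : eval O e v y) {struct H} : P e v y :=
  match H with
  | ev_zero v => Hzero v
  | ev_succ x v => Hsucc x v
  | ev_proj i v => Hproj i v
  | ev_oracle x v => Horacle x v
  | ev_comp _ _ _ _ _ Hgs Hf =>
      Hcomp _ _ _ _ _ (evals_nested_ind _ _ _ Hgs) (eval_nested_ind _ _ _ Hf)
  | ev_prec0 _ g _ _ Hf => Hprec0 _ g _ _ (eval_nested_ind _ _ _ Hf)
  | ev_precS _ _ _ _ _ _ Hy Hz =>
      HprecS _ _ _ _ _ _ (eval_nested_ind _ _ _ Hy) (eval_nested_ind _ _ _ Hz)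
  | ev_mu _ _ _ H0 Hm =>
      Hmu _ _ _ (eval_nested_ind _ _ _ H0) (fun m lt_mn =>
        match Hm m lt_mn with
        | ex_intro k Hk => ex_intro _ k (eval_nested_ind _ _ _ Hk)
        end)
  end
with evals_nested_ind gs v ys (H : evals O gs v ys) {struct H} : Q gs v ys :=
  match H with
  | evs_nil v => Hnil v
  | evs_cons _ _ _ _ _ Hg Hgs =>
      Hcons _ _ _ _ _ (eval_nested_ind _ _ _ Hg) (evals_nested_ind _ _ _ Hgs)
  end.

End EvalInduction.

Lemma eval_comp_inv O f gs v y : eval O (CComp f gs) v y ->
  exists2 ys, evals O gs v ys & eval O f ys y.
Proof. by move=> H; inversion H; subst; exists ys. Qed.

Lemma eval_precS_inv O f g n v z : eval O (CPrec f g) (n.+1 :: v) z ->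
  exists2 y, eval O (CPrec f g) (n :: v) y & eval O g (n :: y :: v) z.
Proof. by move=> H; inversion H; subst; exists y. Qed.

Lemma eval_prec0_inv O f g v y : eval O (CPrec f g) (0 :: v) y -> eval O f v y.
Proof. by move=> H; inversion H. Qed.

Lemma eval_mu_inv O f v n : eval O (CMu f) v n ->
  eval O f (n :: v) 0 /\ forall m, m < n -> exists k, eval O f (m :: v) k.+1.
Proof. by move=> H; inversion H. Qed.

Lemma evals_cons_inv O g gs v zs : evals O (g :: gs) v zs ->
  exists y ys, [/\ zs = y :: ys, eval O g v y & evals O gs v ys].
Proof. by move=> H; inversion H; subst; exists y, ys. Qed.

Lemma eval_det O e v y y' : eval O e v y -> eval O e v y' -> y = y'.
Proof.
move=> H; move: y'; move: e v y H.
apply: (eval_nested_ind O (fun e v y => forall y', eval O e v y' -> y = y')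
  (fun gs v ys => forall ys', evals O gs v ys' -> ys = ys')).
- by move=> v y' H; inversion H.
- by move=> x v y' H; inversion H.
- by move=> i v y' H; inversion H.
- by move=> x v y' H; inversion H.
- move=> f gs v ys y IHgs IHf y' /eval_comp_inv [ys' /IHgs <-].
  exact: IHf.
- by move=> f g v y IH y' /eval_prec0_inv /IH.
- move=> f g n v y z IHy IHz z' /eval_precS_inv [y' /IHy <-].
  exact: IHz.
- move=> f v n IH0 IHm n' /eval_mu_inv [H0 Hm].
  have [lt_n|lt_n|//] := ltngtP n n'.
    by have [k /IH0] := Hm _ lt_n.
  by have [k /(_ _ H0)] := IHm _ lt_n.
- by move=> v ys' H; inversion H.
- by move=> g gs v y ys IHg IHgs _ /evals_cons_inv [y' [ys' [-> /IHg <- /IHgs <-]]].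
Qed.

(** The use principle: a halting computation makes finitely many queries. It yields the continuity
    of Turing functionals on which the separation rests. For [CMu], the uses at the finitely many
    smaller arguments have a common bound. *)
Lemma eval_finite_use O e v y : eval O e v y ->
  exists N, forall O', (forall x, x < N -> O' x = O x) -> eval O' e v y.
Proof.
move: e v y; apply: (eval_nested_ind O
  (fun e v y => exists N, forall O',
    (forall x, x < N -> O' x = O x) -> eval O' e v y)
  (fun gs v ys => exists N, forall O',
    (forall x, x < N -> O' x = O x) -> evals O' gs v ys)).
- by move=> v; exists 0 => O' _; constructor.
- by move=> x v; exists 0 => O' _; constructor.
- by move=> i v; exists 0 => O' _; constructor.
- by move=> x v; exists x.+1 => O' eqO; rewrite -eqO //; constructor.
- move=> f gs v ys y [N1 H1] [N2 H2]; exists (maxn N1 N2) => O' eqO.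
  apply: (ev_comp (ys := ys)); [apply: H1|apply: H2] => x lt_x; apply: eqO;
    by rewrite leq_max lt_x ?orbT.
- by move=> f g v y [N H]; exists N => O' eqO; constructor; apply: H.
- move=> f g n v y z [N1 H1] [N2 H2]; exists (maxn N1 N2) => O' eqO.
  apply: (ev_precS (y := y)); [apply: H1|apply: H2] => x lt_x; apply: eqO;
    by rewrite leq_max lt_x ?orbT.
- move=> f v n [N0 H0] Hm.
  have [||N1 H1] := bounded_collection (fun m N => forall O',
    (forall x, x < N -> O' x = O x) -> exists k, eval O' f (m :: v) k.+1) n.
  + move=> m N N' le_N HN O' eqO; apply: HN => x lt_x; apply: eqO.
    exact: leq_trans lt_x le_N.
  + by move=> m /Hm [k [N HN]]; exists N => O' eqO; exists k; apply: HN.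
  exists (maxn N0 N1) => O' eqO; constructor.
    by apply: H0 => x lt_x; apply: eqO; rewrite leq_max lt_x.
  by move=> m lt_m; apply: H1 => // x lt_x; apply: eqO; rewrite leq_max lt_x orbT.
- by move=> v; exists 0 => O' _; constructor.
- move=> g gs v y ys [N1 H1] [N2 H2]; exists (maxn N1 N2) => O' eqO.
  constructor; [apply: H1|apply: H2] => x lt_x; apply: eqO;
    by rewrite leq_max lt_x ?orbT.
Qed.

(** Composition of functionals: every query becomes a call of [t], so a program can run on an oracle
    that is itself computed from another oracle. *)
Fixpoint subst_oracle (t e : code) : code :=
  match e with
  | COracle => CComp t [:: CProj 0]
  | CComp f gs => CComp (subst_oracle t f) (map (subst_oracle t) gs)
  | CPrec f g => CPrec (subst_oracle t f) (subst_oracle t g)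
  | CMu f => CMu (subst_oracle t f)
  | _ => e
  end.

Lemma eval_subst_oracle O O' t e v y :
  (forall x, eval O' t [:: x] (O x)) -> eval O e v y ->
  eval O' (subst_oracle t e) v y.
Proof.
move=> Ht; move: e v y.
apply: (eval_nested_ind O (fun e v y => eval O' (subst_oracle t e) v y)
  (fun gs v ys => evals O' (map (subst_oracle t) gs) v ys)) => /=.
- by move=> v; constructor.
- by move=> x v; constructor.
- by move=> i v; constructor.
- move=> x v; apply: (ev_comp (ys := [:: x])); last exact: Ht.
  constructor; last by constructor.
  exact: (ev_proj _ 0 (x :: v)).
- by move=> f gs v ys y Hgs Hf; apply: ev_comp Hgs Hf.
- by move=> f g v y Hf; constructor.
- by move=> f g n v y z Hy Hz; apply: ev_precS Hy Hz.
- by move=> f v n H0 Hm; constructor.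
- by move=> v; constructor.
- by move=> g gs v y ys Hg Hgs; constructor.
Qed.

(** * Total computable functions *)

(** One program serves all oracles in [D]. The restriction to [D] admits searches that halt on some
    oracles only, such as reading [i] off a coded [chi i]. *)
Definition computable (D : (nat -> nat) -> Prop) (k : nat)
    (F : (nat -> nat) -> seq nat -> nat) : Prop :=
  exists e, forall O v, D O -> size v = k -> eval O e v (F O v).

Definition computables (D : (nat -> nat) -> Prop) (k : nat)
    (E : (nat -> nat) -> seq nat -> seq nat) : Prop :=
  exists gs, forall O v, D O -> size v = k -> evals O gs v (E O v).

Section Closure.

Variables (D : (nat -> nat) -> Prop) (k : nat).
Implicit Types F A B C : (nat -> nat) -> seq nat -> nat.
Implicit Types P Q : (nat -> nat) -> seq nat -> bool.
Implicit Types E : (nat -> nat) -> seq nat -> seq nat.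

Lemma computable_ext F A :
  (forall O v, D O -> size v = k -> F O v = A O v) ->
  computable D k A -> computable D k F.
Proof. by move=> eqFA [e He]; exists e => O v DO kv; rewrite eqFA //; apply: He. Qed.

Lemma computable_nth i : computable D k (fun O v => nth 0 v i).
Proof. by exists (CProj i) => O v _ _; constructor. Qed.

Lemma computables_cons A E : computable D k A -> computables D k E ->
  computables D k (fun O v => A O v :: E O v).
Proof.
move=> [e He] [gs Hgs]; exists (e :: gs) => O v DO kv.
by constructor; [apply: He | apply: Hgs].
Qed.

Lemma computables_nil : computables D k (fun O v => [::]).
Proof. by exists [::] => O v _ _; constructor. Qed.

Lemma computables_id : computables D k (fun O v => v).
Proof.
exists [seq CProj i | i <- iota 0 k] => O v _ kv.
have: evals O [seq CProj i | i <- iota 0 k] v [seq nth 0 v i | i <- iota 0 k].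
  by elim: (iota 0 k) => [|i s IHs] /=; repeat constructor.
by rewrite map_nth_iota0 -kv ?take_size.
Qed.

Lemma computables_behead E :
  computables D k E -> computables D k (fun O v => behead (E O v)).
Proof.
move=> [gs Hgs]; exists (behead gs) => O v DO kv.
by have := Hgs O v DO kv; case=> *; [exact: evs_nil|].
Qed.

Lemma computable_nth_behead E i :
  computable D k (fun O v => nth 0 (E O v) i.+1) ->
  computable D k (fun O v => nth 0 (behead (E O v)) i).
Proof. by apply: computable_ext => O v _ _; rewrite nth_behead. Qed.

Lemma computable_app m F E : computable D m F -> computables D k E ->
  (forall O v, size v = k -> size (E O v) = m) ->
  computable D k (fun O v => F O (E O v)).
Proof.
move=> [e He] [gs Hgs] sizeE; exists (CComp e gs) => O v DO kv.
by apply: ev_comp; [apply: Hgs | apply: He => //; apply: sizeE].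
Qed.

Lemma computable_app1 (f : (nat -> nat) -> nat -> nat) A :
  computable D 1 (fun O v => f O (nth 0 v 0)) -> computable D k A ->
  computable D k (fun O v => f O (A O v)).
Proof.
move=> Hf HA; apply: (computable_app _ _ (fun O v => [:: A O v]) Hf) => //.
by apply: computables_cons => //; apply: computables_nil.
Qed.

Lemma computable_app2 (f : (nat -> nat) -> nat -> nat -> nat) A B :
  computable D 2 (fun O v => f O (nth 0 v 0) (nth 0 v 1)) ->
  computable D k A -> computable D k B ->
  computable D k (fun O v => f O (A O v) (B O v)).
Proof.
move=> Hf HA HB; apply: (computable_app _ _ (fun O v => [:: A O v; B O v]) Hf) => //.
by repeat (apply: computables_cons => //); apply: computables_nil.
Qed.

Lemma computable_app3 (f : (nat -> nat) -> nat -> nat -> nat -> nat) A B C :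
  computable D 3 (fun O v => f O (nth 0 v 0) (nth 0 v 1) (nth 0 v 2)) ->
  computable D k A -> computable D k B -> computable D k C ->
  computable D k (fun O v => f O (A O v) (B O v) (C O v)).
Proof.
move=> Hf HA HB HC.
apply: (computable_app _ _ (fun O v => [:: A O v; B O v; C O v]) Hf) => //.
by repeat (apply: computables_cons => //); apply: computables_nil.
Qed.

Lemma computable_succ A :
  computable D k A -> computable D k (fun O v => (A O v).+1).
Proof.
apply: (computable_app1 (fun _ n => n.+1)).
by exists CSucc => O [|x [|]] // _ _; constructor.
Qed.

Lemma computable_const n : computable D k (fun O v => n).
Proof.
elim: n => [|n IHn]; last exact: computable_succ.
by exists CZero => O v _ _; constructor.
Qed.

Lemma computable_oracle A :
  computable D k A -> computable D k (fun O v => O (A O v)).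
Proof.
apply: (computable_app1 (fun O n => O n)).
by exists COracle => O [|x [|]] // _ _; constructor.
Qed.

End Closure.

(** Loops are shown computable by rewriting them with [nat_rect]. In [w] the counter and the
    previous value precede the parameters, as in [ev_precS]. *)
Lemma computable_rec D k A (S : (nat -> nat) -> seq nat -> nat -> nat -> nat) N :
  computable D k A ->
  computable D k.+2 (fun O w => S O (behead (behead w)) (nth 0 w 0) (nth 0 w 1)) ->
  computable D k N ->
  computable D k (fun O v => nat_rect (fun _ => nat) (A O v) (S O v) (N O v)).
Proof.
move=> [a Ha] [s Hs] HN.
apply: (computable_app D k k.+1 (fun O w =>
  nat_rect (fun _ => nat) (A O (behead w)) (S O (behead w)) (nth 0 w 0))
  (fun O v => N O v :: v)).
- exists (CPrec a s) => O [|n v] // DO [kv] /=.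
  elim: n => [|n IHn] /=; first by constructor; apply: Ha.
  by apply: ev_precS IHn _; apply: (Hs O [:: n, _ & v]) => //=; rewrite kv.
- by apply: computables_cons => //; apply: computables_id.
- by move=> O v /= ->.
Qed.

Lemma computable_subst_oracle D D' k F (H : (nat -> nat) -> nat -> nat) :
  (forall O, D' O -> D (H O)) ->
  computable D' 1 (fun O v => H O (nth 0 v 0)) -> computable D k F ->
  computable D' k (fun O v => F (H O) v).
Proof.
move=> DH [t Ht] [e He]; exists (subst_oracle t e) => O v DO kv.
apply: eval_subst_oracle; last by apply: He => //; apply: DH.
by move=> x; apply: (Ht O [:: x]).
Qed.

Ltac computable_basic := cbv beta;
  first [ exact: computable_const | exact: computable_nth | assumption
        | apply: computable_succ | apply: computable_oracle
        | apply: computable_nth_behead ].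

(** * Closure under arithmetic, bounded quantifiers and search *)

Section Arithmetic.

Variable D : (nat -> nat) -> Prop.
Implicit Types A B C : (nat -> nat) -> seq nat -> nat.
Implicit Types P Q : (nat -> nat) -> seq nat -> bool.

Lemma computable_add k A B : computable D k A -> computable D k B ->
  computable D k (fun O v => A O v + B O v).
Proof.
apply: (computable_app2 _ _ (fun _ m n => m + n)).
apply: (computable_ext _ _ _ (fun O v => nat_rect (fun _ => nat) (nth 0 v 1)
  (fun _ => succn) (nth 0 v 0))).
  by move=> O v _ _; elim: (nth 0 v 0) => [|n /= <-].
by apply: (computable_rec _ _ _ (fun _ _ _ => succn)); repeat computable_basic.
Qed.

Lemma computable_mul k A B : computable D k A -> computable D k B ->
  computable D k (fun O v => A O v * B O v).
Proof.
apply: (computable_app2 _ _ (fun _ m n => m * n)).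
apply: (computable_ext _ _ _ (fun O v => nat_rect (fun _ => nat) 0
  (fun _ a => nth 0 v 1 + a) (nth 0 v 0))).
  by move=> O v _ _; elim: (nth 0 v 0) => [|n /= <-].
apply: (computable_rec _ _ _ (fun _ v _ a => nth 0 v 1 + a));
  by repeat first [computable_basic | apply: computable_add].
Qed.

Lemma computable_pred k A : computable D k A ->
  computable D k (fun O v => (A O v).-1).
Proof.
apply: (computable_app1 _ _ (fun _ m => m.-1)).
apply: (computable_ext _ _ _ (fun O v => nat_rect (fun _ => nat) 0
  (fun n _ => n) (nth 0 v 0))).
  by move=> O v _ _; case: (nth 0 v 0).
by apply: (computable_rec _ _ _ (fun _ _ n _ => n)); repeat computable_basic.
Qed.

Lemma computable_sub k A B : computable D k A -> computable D k B ->
  computable D k (fun O v => A O v - B O v).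
Proof.
apply: (computable_app2 _ _ (fun _ m n => m - n)).
apply: (computable_ext _ _ _ (fun O v => nat_rect (fun _ => nat) (nth 0 v 0)
  (fun _ => predn) (nth 0 v 1))).
  move=> O v _ _; elim: (nth 0 v 1) => [|n /= <-]; first by rewrite subn0.
  by rewrite subnS.
apply: (computable_rec _ _ _ (fun _ _ _ => predn));
  by repeat first [computable_basic | apply: computable_pred].
Qed.

Lemma computable_exp2 k A : computable D k A ->
  computable D k (fun O v => 2 ^ A O v).
Proof.
apply: (computable_app1 _ _ (fun _ n => 2 ^ n)).
apply: (computable_ext _ _ _ (fun O v => nat_rect (fun _ => nat) 1
  (fun _ a => a + a) (nth 0 v 0))).
  by move=> O v _ _; elim: (nth 0 v 0) => [|n /= <-] //; rewrite addnn expnS mul2n.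
apply: (computable_rec _ _ _ (fun _ _ _ a => a + a));
  by repeat first [computable_basic | apply: computable_add].
Qed.

Lemma computable_neg k P : computable D k (fun O v => P O v : nat) ->
  computable D k (fun O v => ~~ P O v : nat).
Proof.
move=> HP; apply: (computable_ext _ _ _ (fun O v => 1 - P O v)).
  by move=> O v _ _; case: (P O v).
by apply: computable_sub => //; apply: computable_const.
Qed.

Lemma computable_and k P Q : computable D k (fun O v => P O v : nat) ->
  computable D k (fun O v => Q O v : nat) ->
  computable D k (fun O v => P O v && Q O v : nat).
Proof.
move=> HP HQ; apply: (computable_ext _ _ _ (fun O v => P O v * Q O v)).
  by move=> O v _ _; rewrite mulnb.
exact: computable_mul.
Qed.

Lemma computable_imply k P Q : computable D k (fun O v => P O v : nat) ->
  computable D k (fun O v => Q O v : nat) ->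
  computable D k (fun O v => P O v ==> Q O v : nat).
Proof.
move=> HP HQ; apply: (computable_ext _ _ _ (fun O v => ~~ (P O v && ~~ Q O v) : nat)).
  by move=> O v _ _; rewrite negb_and negbK implybE.
by do ?[apply: computable_neg | apply: computable_and].
Qed.

Lemma computable_eq0 k A : computable D k A ->
  computable D k (fun O v => A O v == 0 : nat).
Proof.
move=> HA; apply: (computable_ext _ _ _ (fun O v => 1 - A O v)).
  by move=> O v _ _; case: (A O v) => [|[]].
by apply: computable_sub => //; apply: computable_const.
Qed.

Lemma computable_leq k A B : computable D k A -> computable D k B ->
  computable D k (fun O v => A O v <= B O v : nat).
Proof. by move=> HA HB; apply: computable_eq0; apply: computable_sub. Qed.

Lemma computable_eq k A B : computable D k A -> computable D k B ->
  computable D k (fun O v => A O v == B O v : nat).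
Proof.
move=> HA HB.
apply: (computable_ext _ _ _ (fun O v => (A O v <= B O v) && (B O v <= A O v) : nat)).
  by move=> O v _ _; rewrite eqn_leq.
by apply: computable_and; apply: computable_leq.
Qed.

Lemma computable_if k P A B : computable D k (fun O v => P O v : nat) ->
  computable D k A -> computable D k B ->
  computable D k (fun O v => if P O v then A O v else B O v).
Proof.
move=> HP HA HB.
apply: (computable_ext _ _ _ (fun O v => P O v * A O v + (~~ P O v) * B O v)).
  by move=> O v _ _; case: (P O v); rewrite /= ?mul1n ?addn0.
by apply: computable_add; apply: computable_mul => //; apply: computable_neg.
Qed.

Lemma computable_odd k A : computable D k A ->
  computable D k (fun O v => odd (A O v) : nat).
Proof.
apply: (computable_app1 _ _ (fun _ n => odd n : nat)).
apply: (computable_ext _ _ _ (fun O v => nat_rect (fun _ => nat) 0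
  (fun _ a => 1 - a) (nth 0 v 0))).
  by move=> O v _ _; elim: (nth 0 v 0) => [|n /= <-] //; case: (odd n).
apply: (computable_rec _ _ _ (fun _ _ _ a => 1 - a));
  by repeat first [computable_basic | apply: computable_sub].
Qed.

Lemma computable_half k A : computable D k A ->
  computable D k (fun O v => (A O v)./2).
Proof.
apply: (computable_app1 _ _ (fun _ n => n./2)).
apply: (computable_ext _ _ _ (fun O v => nat_rect (fun _ => nat) 0
  (fun n a => odd n + a) (nth 0 v 0))).
  by move=> O v _ _; elim: (nth 0 v 0) => [|n /= <-] //; rewrite uphalf_half.
apply: (computable_rec _ _ _ (fun _ _ n a => odd n + a));
  by repeat first [computable_basic | apply: computable_add | apply: computable_odd].
Qed.

Lemma computable_iter k (f : (nat -> nat) -> nat -> nat) N A :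
  computable D 1 (fun O v => f O (nth 0 v 0)) ->
  computable D k N -> computable D k A ->
  computable D k (fun O v => iter (N O v) (f O) (A O v)).
Proof.
move=> Hf HN HA.
apply: (computable_ext _ _ _ (fun O v => nat_rect (fun _ => nat) (A O v)
  (fun _ a => f O a) (N O v))).
  by move=> O v _ _; elim: (N O v) => [|n /= ->].
apply: (computable_rec _ _ _ (fun O _ _ a => f O a)) => //.
by apply: (computable_app1 _ _ f) => //; computable_basic.
Qed.

(** An unsuccessful [find] returns the length of the list, so the result grows by one exactly when
    nothing was found below [n] and [n] fails too. This recursion makes bounded search primitive
    recursive. *)
Lemma find_iotaS (p : pred nat) n : find p (iota 0 n.+1) =
  find p (iota 0 n) + ((find p (iota 0 n) == n) && ~~ p n).
Proof.
rewrite -addn1 iotaD find_cat /= size_iota add0n has_find.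
have := find_size p (iota 0 n); rewrite size_iota.
case: ltngtP => // [lt_fn _|-> _]; first by rewrite addn0.
by case: (p n).
Qed.

Lemma computable_find k (P : (nat -> nat) -> seq nat -> nat -> bool) N :
  computable D k.+1 (fun O w => P O (behead w) (nth 0 w 0) : nat) ->
  computable D k N ->
  computable D k (fun O v => find (P O v) (iota 0 (N O v))).
Proof.
move=> HP HN; apply: (computable_ext _ _ _ (fun O v => nat_rect (fun _ => nat) 0
  (fun n a => a + ((a == n) && ~~ P O v n)) (N O v))).
  by move=> O v _ _; elim: (N O v) => // n IHn; rewrite find_iotaS {}IHn.
apply: (computable_rec _ _ _ (fun O v n a => a + ((a == n) && ~~ P O v n))) => //.
  exact: computable_const.
repeat first [computable_basic | apply: computable_add | apply: computable_and
  | apply: computable_neg | apply: computable_eq].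
apply: (computable_app _ _ _ _ (fun O w => nth 0 w 0 :: behead (behead w)) HP).
  apply: computables_cons; first by computable_basic.
  by do 2 apply: computables_behead; apply: computables_id.
by move=> O [|a [|b v]] //= [->].
Qed.

Lemma computable_has k (P : (nat -> nat) -> seq nat -> nat -> bool) N :
  computable D k.+1 (fun O w => P O (behead w) (nth 0 w 0) : nat) ->
  computable D k N ->
  computable D k (fun O v => has (P O v) (iota 0 (N O v)) : nat).
Proof.
move=> HP HN.
apply: (computable_ext _ _ _ (fun O v => find (P O v) (iota 0 (N O v)) < N O v : nat)).
  by move=> O v _ _; rewrite has_find size_iota.
by apply: computable_leq => //; apply: computable_succ; apply: computable_find.
Qed.

Lemma computable_all k (P : (nat -> nat) -> seq nat -> nat -> bool) N :
  computable D k.+1 (fun O w => P O (behead w) (nth 0 w 0) : nat) ->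
  computable D k N ->
  computable D k (fun O v => all (P O v) (iota 0 (N O v)) : nat).
Proof.
move=> HP HN.
apply: (computable_ext _ _ _
  (fun O v => ~~ has (fun n => ~~ P O v n) (iota 0 (N O v)) : nat)).
  by move=> O v _ _; rewrite -all_predC; congr nat_of_bool; apply: eq_all => n /=; rewrite negbK.
apply: computable_neg; apply: (computable_has _ (fun O v n => ~~ P O v n)) => //.
exact: computable_neg.
Qed.

Lemma computable_search k (P : (nat -> nat) -> seq nat -> nat -> bool) N :
  computable D k.+1 (fun O w => P O (behead w) (nth 0 w 0) : nat) ->
  (forall O v, D O -> size v = k ->
    P O v (N O v) /\ forall m, m < N O v -> ~~ P O v m) ->
  computable D k N.
Proof.
(* [CMu] looks for a zero, hence the negated test. *)
move=> /computable_neg [e He] HN; exists (CMu e) => O v DO kv.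
have [PN ltN] := HN O v DO kv; constructor.
  by have /= := He O (N O v :: v) DO; rewrite kv PN; apply.
move=> m /ltN Pm; exists 0.
by have /= := He O (m :: v) DO; rewrite kv Pm; apply.
Qed.

End Arithmetic.

Ltac computable_step := cbv beta;
  lazymatch goal with
  | |- computable _ _ (fun _ _ => nat_of_bool (odd _)) => apply: computable_odd
  | |- _ => first [ computable_basic
    | apply: computable_add | apply: computable_mul | apply: computable_sub
    | apply: computable_pred | apply: computable_exp2 | apply: computable_neg
    | apply: computable_and | apply: computable_imply | apply: computable_leq
    | apply: computable_eq | apply: computable_if | apply: computable_half ]
  end.

(** * Stage-bounded evaluation *)

Notation any_oracle := (fun _ : nat -> nat => True).

(* T s v is 0 as long as no result is found at stage s, and one plus the result afterwards. *)
Definition stage_evaluator (k : nat) (e : code) (T : nat -> seq nat -> nat) : Prop :=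
  [/\ computable any_oracle k.+1 (fun _ w => T (nth 0 w 0) (behead w)),
      forall s s' v y, size v = k -> s <= s' -> T s v = y.+1 -> T s' v = y.+1
    & forall v y, size v = k -> eval (fun _ => 0) e v y <-> exists s, T s v = y.+1].

(** The version for the argument list of [CComp]: [T] tells that all programs of the list have
    returned, and [V] holds their results, which are meaningful only then. *)
Definition stages_evaluator (k : nat) (gs : list code)
    (T : nat -> seq nat -> bool) (V : nat -> seq nat -> seq nat) : Prop :=
  [/\ computable any_oracle k.+1 (fun _ w => T (nth 0 w 0) (behead w) : nat),
      computables any_oracle k.+1 (fun _ w => V (nth 0 w 0) (behead w))
      /\ (forall s v, size (V s v) = size gs),
      forall s s' v, size v = k -> s <= s' -> T s v -> T s' v /\ V s' v = V s v
    & forall v ys, size v = k ->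
        evals (fun _ => 0) gs v ys <-> exists s, T s v /\ V s v = ys].

Lemma stage_evaluator_static k e (A : seq nat -> nat) :
  computable any_oracle k (fun _ v => A v) ->
  (forall v y, size v = k -> eval (fun _ => 0) e v y <-> A v = y.+1) ->
  stage_evaluator k e (fun _ => A).
Proof.
move=> HA HeA; split=> // [|v y kv].
  apply: (computable_app _ _ _ _ (fun _ w => behead w) HA).
    by apply: computables_behead; apply: computables_id.
  by move=> _ [|n v] //= [].
by rewrite HeA //; split=> [->|[]]; first by exists 0.
Qed.

Lemma stage_evaluator_comp k f gs Tf T V :
  stage_evaluator (size gs) f Tf -> stages_evaluator k gs T V ->
  stage_evaluator k (CComp f gs) (fun s v => if T s v then Tf s (V s v) else 0).
Proof.
move=> [cTf mTf eTf] [cT [cV sV] mT eT]; split.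
- apply: computable_if => //; last exact: computable_const.
  apply: (computable_app _ _ _ _ (fun _ w => nth 0 w 0 :: V (nth 0 w 0) (behead w)) cTf).
    by apply: computables_cons => //; apply: computable_nth.
  by move=> _ w _ /=; rewrite sV.
- move=> s s' v y kv le_s; case Ts: (T s v) => // Tfy.
  have [-> ->] := mT _ _ _ kv le_s Ts.
  by apply: mTf Tfy; rewrite ?sV.
- move=> v y kv; split.
    move=> /eval_comp_inv [ys /eT]; case=> // s1 [T1 <-] /eTf; rewrite sV.
    case=> // s2 T2; exists (maxn s1 s2).
    have [-> ->] := mT _ _ _ kv (leq_maxl s1 s2) T1.
    by apply: mTf T2; rewrite ?sV ?leq_maxr.
  move=> [s]; case Ts: (T s v) => // Tfy; apply: (ev_comp (ys := V s v)).
    by apply/eT => //; exists s.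
  by apply/eTf; rewrite ?sV //; exists s.
Qed.

Lemma stages_evaluator_nil k :
  stages_evaluator k [::] (fun _ _ => true) (fun _ _ => [::]).
Proof.
split=> //.
- exact: computable_const.
- by split=> //; apply: computables_nil.
- move=> v ys _; split=> [H|[s [_ <-]]]; last by constructor.
  by inversion H; exists 0.
Qed.

Lemma stages_evaluator_cons k g gs Tg T V :
  stage_evaluator k g Tg -> stages_evaluator k gs T V ->
  stages_evaluator k (g :: gs) (fun s v => (0 < Tg s v) && T s v)
    (fun s v => (Tg s v).-1 :: V s v).
Proof.
move=> [cTg mTg eTg] [cT [cV sV] mT eT]; split.
- by repeat computable_step.
- by split=> [|s v /=]; [apply: computables_cons => //; computable_step | rewrite sV].
- move=> s s' v kv le_s /andP[]; case Tgy: (Tg s v) => [//|y] _ Ts.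
  have [-> ->] := mT _ _ _ kv le_s Ts.
  by rewrite (mTg _ _ _ _ kv le_s Tgy).
- move=> v zs kv; split.
    move=> /evals_cons_inv [y [ys [-> /eTg]]]; case=> // s1 T1 /eT; case=> // s2 [T2 <-].
    have [T3 V3] := mT _ _ _ kv (leq_maxr s1 s2) T2.
    by exists (maxn s1 s2); rewrite (mTg _ _ _ _ kv (leq_maxl s1 s2) T1) T3 V3.
  move=> [s [/andP[]]]; case Tgy: (Tg s v) => [//|y] _ Ts <- /=.
  by constructor; [apply/eTg | apply/eT] => //; exists s.
Qed.

(** The value 0 of an unfinished step is passed on through the recursion; a positive [a] stands for
    the intermediate result [a.-1]. *)
Lemma stage_evaluator_prec k f g Tf Tg :
  stage_evaluator k f Tf -> stage_evaluator k.+2 g Tg ->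
  stage_evaluator k.+1 (CPrec f g) (fun s w => nat_rect (fun _ => nat)
    (Tf s (behead w))
    (fun n a => if a == 0 then 0 else Tg s [:: n, a.-1 & behead w]) (nth 0 w 0)).
Proof.
move=> [cTf mTf eTf] [cTg mTg eTg]; split.
- apply: (computable_rec _ _ _ (fun O w n a =>
    if a == 0 then 0 else Tg (nth 0 w 0) [:: n, a.-1 & behead (behead w)])).
  + apply: (computable_app _ _ _ _
      (fun _ w => nth 0 w 0 :: behead (behead w)) cTf).
      by repeat (apply: computables_cons; first by computable_step);
        do 2 apply: computables_behead; apply: computables_id.
    by move=> _ [|a [|b v]] //= [->].
  + apply: computable_if; [by repeat computable_step | by repeat computable_step|].
    apply: (computable_app _ _ _ _ (fun _ w => [:: nth 0 (behead (behead w)) 0,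
      nth 0 w 0, (nth 0 w 1).-1 & behead (behead (behead (behead w)))]) cTg).
      repeat (apply: computables_cons; first by repeat computable_step).
      by do 4 apply: computables_behead; apply: computables_id.
    by move=> _ [|a [|b [|c [|d v]]]] //= [->].
  + by repeat computable_step.
- move=> s s' [//|n v] y /= [kv] le_s.
  elim: n y => [|n IHn] y /=; first exact: mTf.
  case: ifP => // /eqP; set a := nat_rect _ _ _ n in IHn *.
  case: a IHn => // a IHn _; rewrite (IHn a) //=.
  by apply: mTg; rewrite /= ?kv.
- move=> [//|n v] z /= [kv]; split.
    elim: n z => [|n IHn] z; first by move=> /eval_prec0_inv /eTf; apply.
    move=> /eval_precS_inv [y /IHn [s1 T1] /eTg]; case=> /= [|s2 T2]; first by rewrite kv.
    exists (maxn s1 s2).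
    have -> /= : nat_rect (fun _ => nat) (Tf (maxn s1 s2) v) (fun n a =>
        if a == 0 then 0 else Tg (maxn s1 s2) [:: n, a.-1 & v]) n = y.+1.
      elim: n y T1 {IHn T2} => [|n IHn] y /=; first by apply: mTf; rewrite ?leq_maxl.
      case: ifP => // /eqP; set a := nat_rect _ _ _ n in IHn *.
      case: a IHn => // a IHn _; rewrite (IHn a) //=.
      by apply: mTg; rewrite /= ?kv ?leq_maxl.
    by apply: mTg T2; rewrite /= ?kv ?leq_maxr.
  elim: n z => [|n IHn] z /= [s].
    by move=> Ts; constructor; apply/eTf => //; exists s.
  case: ifP => // /eqP; set a := nat_rect _ _ _ n in IHn *.
  case Ea: a => [//|y] _ Ts; apply: (ev_precS (y := y)).
    by apply: IHn; exists s; rewrite -Ea.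
  by apply/eTg; rewrite /= ?kv //; exists s.
Qed.

(** The test of [n] is guarded by [n < s] because for [n = s] the search fails and [find] returns
    [s] all the same. *)
Lemma find_iota_eq (p : pred nat) n s : n <= s ->
  (n < s -> p n) -> (forall m, m < n -> ~~ p m) -> find p (iota 0 s) = n.
Proof.
move=> le_ns pn npm; apply/eqP; rewrite eqn_leq; apply/andP; split; last first.
  rewrite leqNgt; apply/negP => lt_fn; have /negP := npm _ lt_fn; apply.
  have lt_fs := leq_trans lt_fn le_ns.
  have := nth_find 0 (a := p) (s := iota 0 s).
  by rewrite has_find size_iota lt_fs nth_iota // add0n; apply.
rewrite leqNgt; apply/negP => lt_nf.
have lt_ns : n < s by apply: leq_trans lt_nf _; have := find_size p (iota 0 s); rewrite size_iota.
by have := before_find 0 lt_nf; rewrite nth_iota // add0n pn.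
Qed.

Lemma find_iota_spec (p : pred nat) s m : m < find p (iota 0 s) -> ~~ p m.
Proof.
move=> lt_mf; have := before_find 0 lt_mf.
rewrite nth_iota ?add0n => [->//|].
by apply: leq_trans lt_mf _; have := find_size p (iota 0 s); rewrite size_iota.
Qed.

(** The search stops at the first [n] below [s] whose result is 0 or not yet visible, or else at
    [s]; this number is accepted only if its result is visibly 0. All smaller arguments then have
    visible positive results, so the answer is the least zero and stays so at later stages. *)
Lemma stage_evaluator_mu k f Tf : stage_evaluator k.+1 f Tf ->
  stage_evaluator k (CMu f) (fun s v =>
    if Tf s (find (fun n => Tf s (n :: v) <= 1) (iota 0 s) :: v) == 1
    then (find (fun n => Tf s (n :: v) <= 1) (iota 0 s)).+1 else 0).
Proof.
move=> [cTf mTf eTf]; split.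
- have cfind : computable any_oracle k.+1 (fun _ w =>
      find (fun n => Tf (nth 0 w 0) (n :: behead w) <= 1) (iota 0 (nth 0 w 0))).
    apply: (computable_find _ _ (fun _ w n => Tf (nth 0 w 0) (n :: behead w) <= 1)).
      apply: computable_leq; last exact: computable_const.
      apply: (computable_app _ _ _ _ (fun _ w =>
        [:: nth 0 (behead w) 0, nth 0 w 0 & behead (behead w)]) cTf).
        repeat (apply: computables_cons; first by repeat computable_step).
        by do 2 apply: computables_behead; apply: computables_id.
      by move=> _ [|a [|b v]] //= [->].
    exact: computable_nth.
  apply: computable_if; [|exact: computable_succ|exact: computable_const].
  apply: computable_eq; last exact: computable_const.
  apply: (computable_app _ _ _ _ (fun _ w => [:: nth 0 w 0, find (fun n =>
    Tf (nth 0 w 0) (n :: behead w) <= 1) (iota 0 (nth 0 w 0)) & behead w]) cTf).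
    repeat (apply: computables_cons; first by repeat computable_step).
    by apply: computables_behead; apply: computables_id.
  by move=> _ [|a v] //= [->].
- move=> s s' v y kv le_s; set n := find _ _.
  case: eqP => // Tn [<-] {y}.
  have le_n : n <= s by have := find_size (fun n => Tf s (n :: v) <= 1) (iota 0 s);
    rewrite size_iota.
  have Tn' : Tf s' (n :: v) = 1 by apply: mTf Tn => //=; rewrite kv.
  rewrite (find_iota_eq _ n) ?Tn' ?(leq_trans le_n) //.
  move=> m /find_iota_spec; rewrite -ltnNge; case Tm: (Tf s (m :: v)) => [//|y].
  by rewrite (mTf _ _ _ _ _ le_s Tm) /= ?kv // -ltnNge.
- move=> v n kv; split.
    move=> /eval_mu_inv [H0 Hm].
    have /eTf [/=|s0 T0] := H0; first by rewrite kv.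
    have [||s1 T1] := bounded_collection (fun m s => 1 < Tf s (m :: v)) n.
    + move=> m s s' le_s; case Tm: (Tf s (m :: v)) => [//|y].
      by rewrite (mTf _ _ _ _ _ le_s Tm) /= ?kv.
    + move=> m /Hm [y /eTf [/=|s Ts]]; first by rewrite kv.
      by exists s; rewrite Ts.
    pose s := maxn n (maxn s0 s1).
    have Ts0 : Tf s (n :: v) = 1 by apply: mTf T0; rewrite /= ?kv // /s; lia.
    exists s; have -> : find (fun n => Tf s (n :: v) <= 1) (iota 0 s) = n.
      apply: find_iota_eq => [||m lt_m]; rewrite ?Ts0 //; first by rewrite /s; lia.
      have := T1 m lt_m; case Tm: (Tf s1 (m :: v)) => [//|y].
      by rewrite (mTf s1 s _ _ _ _ Tm) /= ?kv // -?ltnNge // /s; lia.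
    by rewrite Ts0.
  move=> [s]; case: eqP => // Tn [En]; rewrite En in Tn; constructor.
    by apply/eTf; rewrite /= ?kv //; exists s.
  move=> m; rewrite -En => /find_iota_spec; rewrite -ltnNge.
  case Tm: (Tf s (m :: v)) => [//|[//|y]] _; exists y.
  by apply/eTf; rewrite /= ?kv //; exists s.
Qed.

Section CodeInduction.
Variable P : code -> Prop.
Hypotheses (Hzero : P CZero) (Hsucc : P CSucc) (Hproj : forall i, P (CProj i)).
Hypotheses (Horacle : P COracle) (Hmu : forall f, P f -> P (CMu f)).
Hypothesis Hcomp : forall f gs, P f -> foldr (fun g Q => P g /\ Q) True gs -> P (CComp f gs).
Hypothesis Hprec : forall f g, P f -> P g -> P (CPrec f g).

(** Supplies the induction hypothesis for every member of the argument list of [CComp], gathered by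
    [foldr] into one conjunction. *)
Fixpoint code_nested_ind (e : code) : P e :=
  match e with
  | CZero => Hzero
  | CSucc => Hsucc
  | CProj i => Hproj i
  | COracle => Horacle
  | CComp f gs => Hcomp _ gs (code_nested_ind f)
      ((fix all_gs gs : foldr (fun g Q => P g /\ Q) True gs :=
        match gs with
        | [::] => I
        | g :: gs => conj (code_nested_ind g) (all_gs gs)
        end) gs)
  | CPrec f g => Hprec _ _ (code_nested_ind f) (code_nested_ind g)
  | CMu f => Hmu _ (code_nested_ind f)
  end.
End CodeInduction.

(** Kleene's normal form for the zero oracle, by induction on the program: halting becomes the
    existence of a stage, and the stages are total computable. This is what turns a c.e. test into a
    computable enumeration. *)
Lemma normal_form e k : exists T, stage_evaluator k e T.
Proof.
elim/code_nested_ind: e k => [k|k|i k|k|f IHf k|f gs IHf IHgs k|f g IHf IHg k].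
- exists (fun _ _ => 1); apply: (stage_evaluator_static _ _ (fun _ => 1)).
    exact: computable_const.
  by move=> v y _; split=> [H|[<-]]; [inversion H | constructor].
- case: k => [|k].
    (* On the empty list [CSucc] has no value, so no stage shows one. *)
    exists (fun _ _ => 0); apply: (stage_evaluator_static _ _ (fun _ => 0)).
      exact: computable_const.
    by move=> [|//] y _; split=> // H; inversion H.
  exists (fun _ v => (nth 0 v 0).+2).
  apply: (stage_evaluator_static _ _ (fun v => (nth 0 v 0).+2)).
    by repeat computable_step.
  by move=> [//|x v] y _; split=> [H|[<-]]; [inversion H | constructor].
- exists (fun _ v => (nth 0 v i).+1).
  apply: (stage_evaluator_static _ _ (fun v => (nth 0 v i).+1)).
    by repeat computable_step.
  by move=> v y _; split=> [H|[<-]]; [inversion H | constructor].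
- case: k => [|k].
    exists (fun _ _ => 0); apply: (stage_evaluator_static _ _ (fun _ => 0)).
      exact: computable_const.
    by move=> [|//] y _; split=> // H; inversion H.
  exists (fun _ v => 1); apply: (stage_evaluator_static _ _ (fun v => 1)).
    exact: computable_const.
  move=> [//|x v] y _; split=> [H|[<-]]; first by inversion H.
  exact: (ev_oracle (fun _ => 0)).
- by have [Tf HT] := IHf k.+1; eexists; apply: stage_evaluator_mu HT.
- have [Tf HTf] := IHf (size gs).
  suff [T [V HV]] : exists T V, stages_evaluator k gs T V.
    by eexists; apply: stage_evaluator_comp HTf HV.
  elim: gs IHgs {HTf} => [_|g gs IH /= [/(_ k) [Tg HTg] /IH [T [V HV]]]].
    by do 2 eexists; apply: stages_evaluator_nil.
  by do 2 eexists; apply: stages_evaluator_cons HTg HV.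
- case: k => [|k].
    exists (fun _ _ => 0); apply: (stage_evaluator_static _ _ (fun _ => 0)).
      exact: computable_const.
    by move=> [|//] y _; split=> // H; inversion H.
  have [Tf HTf] := IHf k; have [Tg HTg] := IHg k.+2.
  by eexists; apply: stage_evaluator_prec HTf HTg.
Qed.

(** * Martin-Löf tests and enumerations *)

Lemma code_str_surj n : exists s, code_str s = n.
Proof.
elim/ltn_ind: n => -[|n] IHn; first by exists [::].
have [|s Es] := IHn n./2; first by lia.
by exists (odd n :: s) => /=; rewrite Es; lia.
Qed.

Lemma code_str_inj : injective code_str.
Proof.
elim=> [|b s IHs] [|c t] //=; [lia | lia|] => E.
by congr cons; [|apply: IHs]; move: E; case: b; case: c; lia.
Qed.

Lemma code_str_cat s t : code_str (s ++ t) = code_str s + 2 ^ size s * code_str t.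
Proof. by elim: s => [|b s IHs] /=; rewrite ?expn0 ?mul1n // IHs expnS; lia. Qed.

Lemma code_str_bounds s : 2 ^ size s <= (code_str s).+1 < 2 ^ (size s).+1.
Proof.
by elim: s => [|b s] //=; rewrite !(expnS 2 (size s).+1) (expnS 2 (size s)); case: b; lia.
Qed.

Lemma code_str_zeros n : (code_str (nseq n false)).+1 = 2 ^ n.
Proof. by elim: n => //= n IHn; rewrite expnS; lia. Qed.

Lemma code_str_behead s : code_str (behead s) = (code_str s).-1./2.
Proof. by case: s => [|b s] //=; case: b; lia. Qed.

Lemma leq_cpair i j : i <= cpair i j /\ j <= cpair i j.
Proof.
rewrite /cpair; split; last by lia.
have : (i + j) * 2 <= (i + j) * (i + j).+1 + (i == 0) * 2 * j by nia.
by case: eqP => [->|_]; lia.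
Qed.

(** The pairs with sum [n] have their codes in a block of length [n + 1] that starts at the n-th
    triangular number. The blocks are disjoint, so the code determines the sum and then [j]. *)
Lemma cpair_inj i j i' j' : cpair i j = cpair i' j' -> i = i' /\ j = j'.
Proof.
rewrite /cpair => E.
have T n : n.+1 * n.+2 %/ 2 = n * n.+1 %/ 2 + n.+1.
  have -> : n.+1 * n.+2 = n * n.+1 + n.+1 * 2 by nia.
  by rewrite addnC divnMDl // addnC.
have Tmono m n : m < n -> m * m.+1 %/ 2 + m.+1 <= n * n.+1 %/ 2.
  move=> lt_mn; rewrite -T; apply: leq_div2r; nia.
by case: (ltngtP (i + j) (i' + j')) => [/Tmono|/Tmono|Es]; rewrite ?Es in E *; lia.
Qed.

Lemma card_strings m (S : seq (seq bool)) :
  uniq S -> all (fun s => size s == m) S -> size S <= 2 ^ m.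
Proof.
move=> uS /allP sizeS.
have -> : 2 ^ m = size (map val (enum {: m.-tuple bool})).
  by rewrite size_map -cardE card_tuple card_bool.
apply: uniq_leq_size => // s /sizeS sm.
by apply/mapP; exists (Tuple sm); rewrite ?mem_enum.
Qed.

Definition cyl_sub (V : cantor -> Prop) (s : seq bool) : Prop :=
  forall Y, cyl s Y -> V Y.

Lemma cyl_mkseq X n Y : cyl (mkseq X n) Y <-> forall k, k < n -> Y k = X k.
Proof.
split=> H k; last by rewrite size_mkseq => lt_k; rewrite nth_mkseq // H.
by move=> lt_k; rewrite H ?size_mkseq // nth_mkseq.
Qed.

Lemma cyl_cat s t X : cyl (s ++ t) X -> cyl s X.
Proof.
move=> H k lt_k; rewrite H; last by rewrite size_cat ltn_addr.
by rewrite nth_cat lt_k.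
Qed.

(* In R t i c, t is a stage and c the code of a string whose cylinder is found inside V i. *)
Definition enumerates (R : nat -> nat -> nat -> bool) (V : nat -> cantor -> Prop) :=
  computable any_oracle 3 (fun _ v => R (nth 0 v 0) (nth 0 v 1) (nth 0 v 2) : nat) /\
  forall i s, cyl_sub (V i) s <-> exists t, R t i (code_str s).

Lemma computable_cpair D k A B : computable D k A -> computable D k B ->
  computable D k (fun O v => cpair (A O v) (B O v)).
Proof.
move=> HA HB; apply: (computable_ext _ _ _ (fun O v =>
  ((A O v + B O v) * (A O v + B O v).+1)./2 + B O v)).
  by move=> O v _ _; rewrite /cpair divn2.
by repeat computable_step.
Qed.

(** A cylinder is enumerated once the program for the c.e. set is seen to halt on its code; results
    never vanish at later stages, whence the monotonicity. *)
Lemma ce_enumerated V :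
  ce (fun m => exists i s, m = cpair i (code_str s) /\ cyl_sub (V i) s) ->
  exists R, enumerates R V /\
    forall t t' i c, t <= t' -> R t i c -> R t' i c.
Proof.
move=> [e He]; have [T [cT mT eT]] := normal_form e 1.
exists (fun t i c => 0 < T t [:: cpair i c]); split; last first.
  move=> t t' i c le_t; case Tt: (T t _) => [//|y] _.
  by rewrite (mT t t' [:: cpair i c] _ _ le_t Tt).
split.
  apply: computable_leq; first exact: computable_const.
  apply: (computable_app _ _ _ _
    (fun _ v => [:: nth 0 v 0; cpair (nth 0 v 1) (nth 0 v 2)]) cT) => //.
  repeat (apply: computables_cons; first by repeat first
    [apply: computable_cpair | computable_step]).
  exact: computables_nil.
move=> i s; transitivity (exists y, eval (fun _ => 0) e [:: cpair i (code_str s)] y).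
  rewrite -He; split=> [Hs|[i' [s' [/cpair_inj [-> /code_str_inj ->]]]]] //.
  by exists i, s.
split=> [[y /eT] [] // t Tt|[t]]; first by exists t; rewrite Tt.
by case Tt: (T t _) => [//|y] _; exists y; apply/eT => //; exists t.
Qed.

(** Unbounded search for a stage. Within one stage the two components of [m] are sought among the
    numbers up to [m], which suffices by [leq_cpair]. *)
Lemma enumerated_ce R V : enumerates R V ->
  ce (fun m => exists i s, m = cpair i (code_str s) /\ cyl_sub (V i) s).
Proof.
move=> [cR eR].
pose P t m := has (fun i => has (fun c => (m == cpair i c) && R t i c)
  (iota 0 m.+1)) (iota 0 m.+1).
have [e He] : computable any_oracle 2 (fun _ v => ~~ P (nth 0 v 0) (nth 0 v 1) : nat).
  apply: computable_neg; rewrite /P.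
  apply: (computable_has _ _ (fun _ v i => has (fun c =>
    (nth 0 v 1 == cpair i c) && R (nth 0 v 0) i c) (iota 0 (nth 0 v 1).+1))).
    apply: (computable_has _ _ (fun _ v c =>
      (nth 0 (behead v) 1 == cpair (nth 0 v 0) c) && R (nth 0 (behead v) 0) (nth 0 v 0) c)).
      apply: computable_and.
        by repeat first [apply: computable_cpair | computable_step].
      by apply: (computable_app3 _ _ (fun _ t i c => R t i c : nat)) => //;
        repeat computable_step.
    by repeat computable_step.
  by repeat computable_step.
have HP t m : P t m <-> exists i s, m = cpair i (code_str s) /\ R t i (code_str s).
  split.
    move=> /hasP[i _ /hasP[c _ /andP[/eqP -> Rt]]].
    by have [s Es] := code_str_surj c; exists i, s; rewrite Es.
  move=> [i [s [-> Rt]]]; have [le_i le_s] := leq_cpair i (code_str s).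
  apply/hasP; exists i; first by rewrite mem_iota ltnS.
  by apply/hasP; exists (code_str s); rewrite ?mem_iota ?ltnS // eqxx.
exists (CMu e) => m; transitivity (exists t, P t m).
  split=> [[i [s [-> /eR [t Rt]]]]|[t /HP [i [s [-> Rt]]]]].
    by exists t; apply/HP; exists i, s.
  by exists i, s; split=> //; apply/eR; exists t.
split=> [|[t /eval_mu_inv [H0 _]]].
  move=> /least_nat [t [Pt ltP]]; exists t; constructor.
    by have /= := He (fun _ => 0) [:: t; m] I erefl; rewrite Pt.
  move=> t' /ltP /negP Pt'; exists 0.
  by have /= := He (fun _ => 0) [:: t'; m] I erefl; rewrite Pt'.
exists t; have /= := eval_det _ _ _ _ _ H0 (He (fun _ => 0) [:: t; m] I erefl).
by case: (P t m).
Qed.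

(** * Tests pulled back along shifts, and randomness under finite changes *)

Definition scons (b : bool) (X : cantor) : cantor :=
  fun n => if n is m.+1 then X m else b.

Definition sdrop (n : nat) (X : cantor) : cantor := fun k => X (n + k).

Lemma cyl_scons b s X : cyl (b :: s) (scons b X) <-> cyl s X.
Proof. by split=> [H k /(H k.+1)|H [|k]] //; apply: H. Qed.

Lemma scons_sdrop X : scons (X 0) (sdrop 1 X) = X.
Proof. by apply: functional_extensionality => -[|n]. Qed.

Section Tests.

Variables (U : nat -> cantor -> Prop) (HU : ML_test U).

(** The shift preserves measure: for each of the two first bits, the strings of length [n.+1] inside
    the preimage lose that bit and become distinct strings of length [n] inside [U i]. *)
Lemma ML_test_sdrop : ML_test (fun i X => U i (sdrop 1 X)).
Proof.
have [openU ceU leU] := HU.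
have subE i s : cyl_sub (fun X => U i (sdrop 1 X)) s <-> cyl_sub (U i) (behead s).
  case: s => [|b s] /=; split=> H Y HY.
  - by have := H (scons false Y); apply.
  - exact: H.
  - by have := H (scons b Y); rewrite cyl_scons; apply.
  - by apply: H => k lt_k; rewrite /sdrop HY.
split.
- move=> i X /openU [n Hn]; exists n.+1 => Y /cyl_mkseq HY; apply: Hn.
  by apply/cyl_mkseq => k lt_k; apply: HY.
- have [R [[cR eR] _]] := ce_enumerated _ ceU.
  apply: (enumerated_ce (fun t i c => R t i c.-1./2)); split.
    by apply: (computable_app3 _ _ (fun _ t i c => R t i c : nat)) => //;
      repeat computable_step.
  by move=> i s; rewrite subE eR code_str_behead.
- move=> i [|n] S uS sizeS subS.
    apply: (leU i 0 S uS sizeS) => s sS; have /subE := subS s sS.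
    by have /allP /(_ s sS) := sizeS; case: s sS.
  have half_le b : count (fun s => head false s == b) S * 2 ^ i <= 2 ^ n.
    rewrite -size_filter -(size_map behead); apply: leU.
    - rewrite map_inj_in_uniq ?filter_uniq // => -[|a s] [|a' s'];
        rewrite !mem_filter; last by move=> /andP[/= /eqP -> _] /andP[/= /eqP -> _] ->.
      + by [].
      + by move=> /andP[_ /(allP sizeS)].
      + by move=> _ /andP[_ /(allP sizeS)].
    - apply/allP => s /mapP[s']; rewrite mem_filter => /andP[_ /(allP sizeS) /eqP Es] ->.
      by rewrite size_behead Es.
    - move=> s /mapP[s']; rewrite mem_filter => /andP[_ /subS] /subE H ->; exact: H.
  have := half_le true; have := half_le false.
  rewrite -(count_predC (fun s => head false s == true) S).
  rewrite (eq_count (a1 := predC _) (a2 := fun s => head false s == false)).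
    by rewrite expnS; lia.
  by move=> s /=; case: (head false s).
Qed.

(** Stripping a fixed first bit at most doubles the measure, which the index [i.+1] makes up for. *)
Lemma ML_test_scons b : ML_test (fun i X => U i.+1 (scons b X)).
Proof.
have [openU ceU leU] := HU.
have subE i s : cyl_sub (fun X => U i.+1 (scons b X)) s <-> cyl_sub (U i.+1) (b :: s).
  split=> H Y HY; last by apply: H; apply/cyl_scons.
  rewrite -(scons_sdrop Y) (HY 0 isT); apply: H.
  by move=> k /(HY k.+1).
split.
- move=> i X /openU [n Hn]; exists n => Y /cyl_mkseq HY; apply: Hn.
  by apply/cyl_mkseq => -[|k] //= lt_k; apply: HY; apply: ltnW.
- have [R [[cR eR] _]] := ce_enumerated _ ceU.
  apply: (enumerated_ce (fun t i c => R t i.+1 (c + c + 1 + b))); split.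
    by apply: (computable_app3 _ _ (fun _ t i c => R t i c : nat)) => //;
      repeat computable_step.
  by move=> i s; rewrite subE eR /= addnn.
- move=> i n S uS /allP sizeS subS.
  have := leU i.+1 n.+1 (map (cons b) S); rewrite size_map !expnS mulnCA leq_pmul2l //; apply.
  + by rewrite map_inj_uniq // => s s' [].
  + by apply/allP => s /mapP[s' /sizeS /eqP <- ->].
  + by move=> s /mapP[s' /subS /subE H ->].
Qed.

End Tests.

(** By universality this test puts the zero sequence into every [U i]. A string begins with [i]
    zeros exactly when [2 ^ i] divides its code plus one, which makes the enumeration computable. *)
Lemma ML_test_zeros : ML_test (fun i X => forall k, k < i -> X k = false).
Proof.
have subE i s : cyl_sub (fun X => forall k, k < i -> X k = false) s <->
    exists t, (code_str s).+1 = 2 ^ i * t.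
  split.
    (* Extending [s] by ones forces the [i] zeros to lie within [s] itself. *)
    move=> /(_ (nth true s)) H.
    have {}H : forall k, k < i -> nth true s k = false.
      by apply: H => k lt_k; apply: set_nth_default.
    elim: i s H => [|i IHi] s H; first by exists (code_str s).+1; rewrite mul1n.
    case: s H => [|b s] H; first by have := H 0 isT.
    have [|t Et] := IHi s; first by move=> k /(H k.+1).
    by have /= -> := H 0 isT; exists t; rewrite expnS; nia.
  move=> [t Et] Y; elim: i s Et Y => [//|i IHi] [|b s] /= Et Y HY.
    by move: Et; rewrite expnS; nia.
  have b0 : b = false by move: Et; rewrite expnS; case: (b) => //; nia.
  move=> [|k]; first by rewrite (HY 0 isT).
  rewrite ltnS => lt_k; apply: (IHi s _ (sdrop 1 Y)) lt_k.
    by move: Et; rewrite expnS b0; nia.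
  by move=> k' /(HY k'.+1).
split.
- by move=> i X HX; exists i => Y /cyl_mkseq HY k lt_k; rewrite HY // HX.
- apply: (enumerated_ce (fun t i c => c.+1 == 2 ^ i * t)); split.
    by repeat computable_step.
  by move=> i s; rewrite subE; split=> -[t Et]; exists t; apply/eqP.
- move=> i n S uS /allP sizeS subS.
  have prefixS s : s \in S -> i <= n /\ s = nseq i false ++ drop i s.
    move=> sS; have Hs : forall k, k < i -> nth true s k = false.
      by apply: (subS s sS (nth true s)) => k lt_k; apply: set_nth_default.
    have le_is : i <= size s.
      by rewrite leqNgt; apply/negP => /Hs; rewrite nth_default.
    split; first by rewrite -(eqP (sizeS s sS)).
    rewrite -[LHS](cat_take_drop i); congr cat.
    apply: (@eq_from_nth _ true); first by rewrite size_nseq size_takel.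
    by move=> k; rewrite size_takel // => lt_k; rewrite nth_take // nth_nseq lt_k Hs.
  have [le_in|lt_ni] := leqP i n; last first.
    case: S {uS sizeS subS} prefixS => // s S /(_ s (mem_head _ _)) [].
    by rewrite leqNgt lt_ni.
  rewrite -(subnK le_in) expnD leq_pmul2r ?expn_gt0 // -(size_map (drop i)).
  apply: card_strings.
    rewrite map_inj_in_uniq // => s s' /prefixS [_ ->] /prefixS [_ ->].
    by rewrite !drop_size_cat ?size_nseq // => ->.
  by apply/allP => s /mapP[s' /sizeS /eqP s'n ->]; rewrite size_drop s'n.
Qed.

Section Randomness.

Variables (U : nat -> cantor -> Prop) (HU : universal_ML_test U).

(** If the shift of a sequence lay in every [U i], the sequence would fail the pulled-back test and,
    by universality, lie in every [U i] too. *)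
Lemma MLR_sdrop n X : MLR U X -> MLR U (sdrop n X).
Proof.
elim: n => [|n IHn] // RX.
have -> : sdrop n.+1 X = sdrop 1 (sdrop n X).
  by apply: functional_extensionality => k; rewrite /sdrop addSnnS.
move=> HX; apply: (IHn RX); apply: (HU.2 _ (ML_test_sdrop _ HU.1)) => i; exact: HX.
Qed.

Lemma MLR_scons b X : MLR U X -> MLR U (scons b X).
Proof. by move=> RX HX; apply: RX; apply: (HU.2 _ (ML_test_scons _ HU.1 b)). Qed.

(** [s] followed by zeros is not random: otherwise its shifts would be random, down to the zero
    sequence, which [ML_test_zeros] excludes. So it lies in [U i], and by openness finitely many of
    the zeros suffice. *)
Lemma zeros_extend s i : exists m, cyl_sub (U i) (s ++ nseq m false).
Proof.
have H0 : forall i, U i (fun _ => false) by apply: (HU.2 _ ML_test_zeros).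
have Hs : forall i, U i (nth false s).
  elim: s => [|b s IHs] {i} i.
    suff -> : nth false [::] = (fun _ => false) by [].
    by apply: functional_extensionality => k; rewrite nth_nil.
  have -> : nth false (b :: s) = scons b (nth false s).
    by apply: functional_extensionality => -[|k].
  apply: NNPP => NU; have R : MLR U (scons b (nth false s)) by move=> /(_ i).
  exact: (MLR_sdrop 1 _ R).
have [[openU _ _] _] := HU; have [n Hn] := openU i _ (Hs i).
exists n => Y HY; apply: Hn; apply/cyl_mkseq => k lt_k.
rewrite HY ?size_cat ?size_nseq ?ltn_addl // nth_cat nth_nseq.
by case: ltnP => // le_k; rewrite nth_default //; case: ifP.
Qed.

End Randomness.

(** * Reducing limits to layers *)

Definition code_len (c : nat) : nat := find (fun l => c.+1 < 2 ^ l.+1) (iota 0 c.+1).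

Lemma code_lenE s : code_len (code_str s) = size s.
Proof.
have /andP[le_s lt_s] := code_str_bounds s.
apply: find_iota_eq => // [|m lt_m].
  by apply: leq_trans le_s; apply: ltnW; apply: ltn_expl.
by rewrite -leqNgt; apply: leq_trans le_s; rewrite leq_exp2l.
Qed.

Lemma computable_code_len D k A :
  computable D k A -> computable D k (fun O v => code_len (A O v)).
Proof.
apply: (computable_app1 _ _ (fun _ c => code_len c)); rewrite /code_len.
by apply: (computable_find _ _ (fun _ v l => (nth 0 v 0).+1 < 2 ^ l.+1));
  repeat computable_step.
Qed.

Definition pad_code (c m : nat) : nat := c + 2 ^ code_len c * (2 ^ m).-1.

Lemma pad_codeE s m : pad_code (code_str s) m = code_str (s ++ nseq m false).
Proof. by rewrite /pad_code code_lenE code_str_cat -(code_str_zeros m). Qed.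

Lemma computable_pad_code D k A B : computable D k A -> computable D k B ->
  computable D k (fun O v => pad_code (A O v) (B O v)).
Proof.
move=> HA HB; rewrite /pad_code.
by repeat first [apply: computable_code_len | computable_step].
Qed.

(** Each iteration drops the first bit, and the first bit of a nonempty string is 0 exactly when its
    code is odd. *)
Definition bit_code (n c : nat) : bool := ~~ odd (iter n (fun c => c.-1./2) c).

Lemma bit_codeE n s : n < size s -> bit_code n (code_str s) = nth false s n.
Proof.
rewrite /bit_code => lt_n.
have -> : iter n (fun c => c.-1./2) (code_str s) = code_str (drop n s).
  elim: n {lt_n} => [|n IHn]; first by rewrite drop0.
  by rewrite iterS IHn -code_str_behead -drop1 drop_drop.
by rewrite (drop_nth false) //=; case: (nth _ _ _); lia.
Qed.

(** Every nonzero value is read as a one, so prefixes make sense for arbitrary oracles. *)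
Definition prefix_code (O : nat -> nat) (n : nat) : nat :=
  code_str (mkseq (fun k => O k != 0) n).

Lemma computable_prefix_code D k A :
  computable D k A -> computable D k (fun O v => prefix_code O (A O v)).
Proof.
apply: (computable_app1 _ _ prefix_code).
apply: (computable_ext _ _ _ (fun O v => nat_rect (fun _ => nat) 0
  (fun n a => a + 2 ^ n * (1 + (O n != 0))) (nth 0 v 0))).
  move=> O v _ _; elim: (nth 0 v 0) => //= n <-.
  by rewrite /prefix_code mkseqS -cats1 code_str_cat size_mkseq.
apply: (computable_rec _ _ _ (fun O _ n a => a + 2 ^ n * (1 + (O n != 0))));
  by repeat computable_step.
Qed.

Lemma prefix_code_bits X n : prefix_code (bits X) n = code_str (mkseq X n).
Proof.
by rewrite /prefix_code; congr code_str; apply: eq_mkseq => k; rewrite /bits; case: (X k).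
Qed.

Section LimitReduction.

Variables (U : nat -> cantor -> Prop) (HU : universal_ML_test U).
Variable R : nat -> nat -> nat -> bool.
Hypothesis enumR : enumerates R U.
Hypothesis monoR : forall t t' i c, t <= t' -> R t i c -> R t' i c.
Variable G : (nat -> nat) -> nat -> nat.
Hypothesis computableG : computable any_oracle 1 (fun O v => G O (nth 0 v 0)).

(** [N] is both a stage of the enumeration and a bound on the number of zeros: at stage [N], for
    every [i <= s], the string coded by [c] is seen to enter [U i] after at most [N] zeros. *)
Let padded (c s N : nat) : bool :=
  all (fun i => has (fun m => R N i (pad_code c m)) (iota 0 N.+1)) (iota 0 s.+1).

Let padded_ex c s : exists N, padded c s N.
Proof.
have [w <-] := code_str_surj c.
have [||N HN] := bounded_collection (fun i N =>
  has (fun m => R N i (pad_code (code_str w) m)) (iota 0 N.+1)) s.+1.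
- move=> i N N' le_N /hasP[m]; rewrite mem_iota => /andP[_ lt_m] Rm.
  by apply/hasP; exists m; [rewrite mem_iota; lia | apply: monoR Rm].
- move=> i _; have [m Hm] := zeros_extend U HU w i.
  have [t Rt] := (enumR.2 i _).1 Hm; exists (maxn t m); apply/hasP; exists m.
    by rewrite mem_iota ltnS leq_maxr.
  by rewrite pad_codeE; apply: monoR Rt; rewrite leq_maxl.
- by exists N; apply/allP => i; rewrite mem_iota => /HN.
Qed.

Let pad_length (O : nat -> nat) (s c : nat) : nat :=
  if G O s.+1 == G O s then 0 else ex_minn (padded_ex c s.+1).

Let computable_pad_length :
  computable any_oracle 2 (fun O v => pad_length O (nth 0 v 0) (nth 0 v 1)).
Proof.
apply: computable_if; last 1 first.
- apply: (computable_search _ _ (fun _ v N => padded (nth 0 v 1) (nth 0 v 0).+1 N)).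
    rewrite /padded; apply: (computable_all _ _ (fun _ w i => has
      (fun m => R (nth 0 w 0) i (pad_code (nth 0 (behead w) 1) m)) (iota 0 (nth 0 w 0).+1))).
      apply: (computable_has _ _ (fun _ w m => R (nth 0 (behead w) 0) (nth 0 w 0)
        (pad_code (nth 0 (behead (behead w)) 1) m))).
        apply: (computable_app3 _ _ (fun _ t i c => R t i c : nat));
          first [exact: enumR.1 | by repeat first [apply: computable_pad_code | computable_step]].
      by repeat computable_step.
    by repeat computable_step.
  move=> O v _ _; case: ex_minnP => N PN leN; split=> // m.
  by rewrite ltnNge; apply: contra; apply: leN.
- by apply: computable_eq; apply: (computable_app1 _ _ G) => //; repeat computable_step.
- exact: computable_const.
Qed.

(* The output copies the input but, whenever the approximation G changes at stage s + 1,
   first inserts enough zeros to enter U i for all i <= s + 1. *)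
Let output_prefix (O : nat -> nat) : nat -> seq bool := fix f n :=
  if n is s.+1
  then f s ++ nseq (pad_length O s (code_str (f s))) false ++ [:: O s != 0]
  else [::].

Let output (O : nat -> nat) : cantor := fun n => nth false (output_prefix O n.+1) n.

Let size_output_prefix O n : n <= size (output_prefix O n).
Proof. by elim: n => //= n IHn; rewrite !size_cat /=; lia. Qed.

Let output_prefixD O n m : exists t, output_prefix O (n + m) = output_prefix O n ++ t.
Proof.
elim: m => [|m [t Et]]; first by exists [::]; rewrite addn0 cats0.
by rewrite addnS /= Et -catA; eexists; reflexivity.
Qed.

Let cyl_output O n : cyl (output_prefix O n) (output O).
Proof.
move=> k lt_k; rewrite /output; have [le_kn|lt_nk] := leqP k.+1 n.
  have [t Et] := output_prefixD O k.+1 (n - k.+1); rewrite subnKC // in Et.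
  by rewrite Et nth_cat size_output_prefix.
have [t Et] := output_prefixD O n (k.+1 - n); rewrite subnKC // in Et; last by lia.
by rewrite Et nth_cat lt_k.
Qed.

Let computable_output : exists e, forall O, runs e O (bits (output O)).
Proof.
have [e He] : computable any_oracle 1 (fun O v => bits (output O) (nth 0 v 0)).
  have cC : computable any_oracle 1 (fun O v => code_str (output_prefix O (nth 0 v 0))).
    apply: (computable_ext _ _ _ (fun O v => nat_rect (fun _ => nat) 0 (fun s c =>
        pad_code c (pad_length O s c) +
        2 ^ (code_len c + pad_length O s c) * (1 + (O s != 0))) (nth 0 v 0))).
      move=> O v _ _; elim: (nth 0 v 0) => // n IHn.
      rewrite [RHS]/= -IHn [output_prefix O n.+1]/= catA code_str_cat -pad_codeE.
      by rewrite size_cat size_nseq -code_lenE; case: (O n != 0).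
    apply: (computable_rec _ _ _ (fun O _ s c => pad_code c (pad_length O s c) +
        2 ^ (code_len c + pad_length O s c) * (1 + (O s != 0)))).
    - exact: computable_const.
    - by repeat first [ exact: computable_pad_length
        | apply: computable_pad_code | apply: computable_code_len
        | apply: (computable_app2 _ _ pad_length) | computable_step].
    - by repeat computable_step.
  apply: (computable_ext _ _ _ (fun O v =>
      bit_code (nth 0 v 0) (code_str (output_prefix O (nth 0 v 0).+1)) : nat)).
    by move=> O v _ _; rewrite bit_codeE // size_output_prefix.
  rewrite /bit_code; apply: computable_neg; apply: computable_odd.
  apply: (computable_iter _ _ (fun _ c => c.-1./2)); try by repeat computable_step.
  apply: (computable_app1 _ _ (fun O n => code_str (output_prefix O n))) => //.
  by repeat computable_step.
by exists e => O n; apply: He.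
Qed.

(** From stage [s0] on nothing is inserted, so the output is a finite string followed by a tail of
    [X], and randomness survives both changes. *)
Let MLR_output X s0 : MLR U X ->
  (forall s, s0 <= s -> G (bits X) s.+1 = G (bits X) s) -> MLR U (output (bits X)).
Proof.
move=> RX stable; set O := bits X in stable *.
have E k : output_prefix O (s0 + k) = output_prefix O s0 ++ mkseq (sdrop s0 X) k.
  elim: k => [|k IHk]; first by rewrite addn0 cats0.
  rewrite addnS /= {1}IHk /pad_length stable ?leq_addr // eqxx /= mkseqS -cats1 catA.
  by rewrite /O /bits /sdrop; case: (X _).
have -> : output O = foldr scons (sdrop s0 X) (output_prefix O s0).
  apply: functional_extensionality => n.
  have H Y : cyl (output_prefix O (s0 + n.+1)) Y -> Y n = nth false (output_prefix O (s0 + n.+1)) n.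
    by move=> HY; apply: HY; apply: leq_trans (size_output_prefix _ _); rewrite leq_addl.
  rewrite (H _ (cyl_output _ _)); symmetry; apply: H; rewrite E.
  elim: (output_prefix O s0) => [|b s IHs] /=.
    by apply/cyl_mkseq.
  by apply/cyl_scons.
by elim: (output_prefix O s0) => [|b s IHs] /=; [apply: MLR_sdrop|apply: MLR_scons].
Qed.

(** A change at stage [s.+1] would have inserted enough zeros to bring the output into [U i]. *)
Let stable_output O i s : ~ U i (output O) -> i <= s.+1 -> G O s.+1 = G O s.
Proof.
move=> NU le_is; apply/eqP/negP => /negP neqG; apply: NU.
have := cyl_output O s.+1; rewrite /= /pad_length (negbTE neqG).
case: ex_minnP => N /allP /(_ i) PN _ Hcyl.
have /hasP[m] : has (fun m => R N i (pad_code (code_str (output_prefix O s)) m)) (iota 0 N.+1).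
  by apply: PN; rewrite mem_iota.
rewrite mem_iota add0n ltnS => le_mN; rewrite pad_codeE => Rm.
have /(_ (output O)) := (enumR.2 i _).2 (ex_intro _ N Rm); apply.
move: Hcyl; have -> : nseq N false = nseq m false ++ nseq (N - m) false.
  by rewrite -nseqD subnKC.
by rewrite -!catA catA; apply: cyl_cat.
Qed.

(** The forward functional produces the padded copy of [X]. Any layer [i] returned for it bounds the
    last change of the approximation, so the backward functional computes [L X] as [G] at stage [i]
    and runs [e] on [X] paired with it. *)
Lemma limit_weihrauch (Y : Type) (repY : Y -> (nat -> nat) -> Prop)
    (f : cantor -> Y) (L : cantor -> nat) (e : code) :
  (forall X, MLR U X -> exists s0, forall s, s0 <= s -> G (bits X) s = L X) ->
  (forall X, MLR U X -> exists q,
     runs e (bpair (bits X) (chi (L X))) q /\ repY (f X) q) ->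
  weihrauch_le (restr_MLR U f) (rep_MLR U) repY (LAY U) (rep_MLR U) rep_nat.
Proof.
move=> limG comp_e.
(* [Q] stands for the pair of [X] and [chi i]: even positions hold [X], odd ones [chi i], and
   [layer] recovers [i]. *)
pose hit (Q : nat -> nat) n := Q (n + n).+1 != 0.
pose D (Q : nat -> nat) := exists n, hit Q n.
pose layer Q := epsilon (inhabits 0) (fun n => hit Q n /\ forall m, m < n -> ~ hit Q m).
have layerP Q : D Q -> hit Q (layer Q) /\ forall m, m < layer Q -> ~~ hit Q m.
  move=> /least_nat DQ; have [H ltH] := epsilon_spec (inhabits 0) _ DQ.
  by split=> // m /ltH /negP.
have clayer : computable D 1 (fun Q _ => layer Q).
  apply: (computable_search _ _ (fun Q _ n => hit Q n)); last by move=> Q v /layerP.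
  by rewrite /hit; repeat computable_step.
pose left (Q : nat -> nat) n := Q (n + n).
have cG : computable D 1 (fun Q v => G (left Q) (layer Q)).
  apply: (computable_app1 _ _ (fun Q n => G (left Q) n)) => //.
  apply: (computable_subst_oracle any_oracle _ _ (fun O v => G O (nth 0 v 0))) => //.
  by rewrite /left; repeat computable_step.
have [t Ht] : computable D 1 (fun Q v => bpair (left Q) (chi (G (left Q) (layer Q))) (nth 0 v 0)).
  rewrite /bpair /left /chi.
  apply: computable_if; [by repeat computable_step | | by repeat computable_step].
  by apply: computable_eq; [repeat computable_step | exact: cG].
have [ePhi HPhi] := computable_output.
exists ePhi, (subst_oracle t e) => Gamma HGamma p X [RX pX] _.
have {pX} -> : p = bits X by apply: functional_extensionality.
have [s0 Hs0] := limG X RX.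
have RY : MLR U (output (bits X)).
  by apply: (MLR_output _ s0) => // s le_s; rewrite !Hs0 // leqW.
exists (bits (output (bits X))); split=> //.
have [||q2 [Gq2 [i [q2i [_ NU]]]]] := HGamma (bits (output (bits X))) (output (bits X)).
- by [].
- by have [i Ni] := not_all_ex_not _ _ RY; exists i.
exists q2; split=> //.
have [q3 [run_e repq3]] := comp_e X RX; exists q3; split; last by exists (f X).
have -> : q2 = chi i by apply: functional_extensionality.
set Q := bpair _ _.
have hitQ n : hit Q n = (n == i).
  by rewrite /hit /Q /bpair /= addnn odd_double /= uphalf_double /chi; case: (n == i).
have DQ : D Q by exists i; rewrite hitQ.
have layerQ : layer Q = i by have [/[!hitQ] /eqP] := layerP Q DQ.
have leftQ : left Q = bits X.
  by apply: functional_extensionality => n; rewrite /left /Q /bpair addnn odd_double doubleK.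
have GQ : G (bits X) i = L X.
  rewrite -(Hs0 (maxn i s0)) ?leq_maxr //.
  have Gi k : G (bits X) (i + k) = G (bits X) i.
    elim: k => [|k IHk]; first by rewrite addn0.
    by rewrite addnS (stable_output _ i) // -addnS leq_addr.
  by rewrite -(Gi (maxn i s0 - i)) subnKC ?leq_maxl.
move=> n; apply: eval_subst_oracle (run_e n) => x.
by have /= := Ht Q [:: x] DQ erefl; rewrite leftQ layerQ GQ.
Qed.

End LimitReduction.

(** The layer [rd X] is a limit: at stage [s] take the least [j] for which no prefix of [X] of
    length at most [s] is seen inside [U j]. For [j < rd X] such a prefix eventually shows up, for
    [j = rd X] never. *)
Lemma exactly_layerwise_weihrauch U (HU : universal_ML_test U) (Y : Type)
    (repY : Y -> (nat -> nat) -> Prop) (f : cantor -> Y) :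
  exactly_layerwise_computable U repY f ->
  weihrauch_le (restr_MLR U f) (rep_MLR U) repY (LAY U) (rep_MLR U) rep_nat.
Proof.
move=> [e He]; have [[openU ceU _] _] := HU.
have [R [enumR monoR]] := ce_enumerated _ ceU.
pose entered O s j := has (fun n => R s j (prefix_code O n)) (iota 0 s.+1).
pose G O s := find (fun j => ~~ entered O s j) (iota 0 s.+1).
pose rd X := epsilon (inhabits 0) (is_rd U X).
have rdP X : MLR U X -> is_rd U X (rd X).
  move=> /not_all_ex_not /least_nat [i [NUi ltU]].
  by apply: epsilon_spec; exists i; split=> // j /ltU /NNPP.
apply: (limit_weihrauch U HU R enumR monoR G _ Y repY f rd e).
- rewrite /G; apply: (computable_find _ _ (fun O w j => ~~ entered O (nth 0 w 0) j)).
    apply: computable_neg; rewrite /entered.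
    apply: (computable_has _ _ (fun O w n =>
      R (nth 0 (behead w) 0) (nth 0 w 0) (prefix_code O n))).
      apply: (computable_app3 _ _ (fun _ t i c => R t i c : nat));
        first [exact: enumR.1 | by repeat first [apply: computable_prefix_code | computable_step]].
    by repeat computable_step.
  by repeat computable_step.
- move=> X /rdP [NUrd Ult].
  have [||s1 Hs1] := bounded_collection (fun j s => entered (bits X) s j) (rd X).
  + move=> j s s' le_s /hasP[n]; rewrite mem_iota => /andP[_ lt_n] Rn.
    by apply/hasP; exists n; [rewrite mem_iota; lia | apply: monoR Rn].
  + move=> j /Ult /openU [n /((enumR.2 j _).1) [t Rt]].
    exists (maxn n t); apply/hasP; exists n; first by rewrite mem_iota ltnS leq_maxl.
    by rewrite prefix_code_bits; apply: monoR Rt; rewrite leq_maxr.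
  exists (maxn s1 (rd X)) => s; rewrite geq_max => /andP[le_s1 le_rd].
  apply: find_iota_eq; first exact: leqW.
    move=> _; apply/hasP => -[n _]; rewrite prefix_code_bits => Rn; apply: NUrd.
    by apply: ((enumR.2 (rd X) (mkseq X n)).2 (ex_intro _ s Rn)); apply/cyl_mkseq.
  move=> j /Hs1 /hasP[n]; rewrite mem_iota negbK => /andP[_ lt_n] Rn.
  by apply/hasP; exists n; [rewrite mem_iota; lia | apply: monoR Rn].
- by move=> X RX; apply: He => //; apply: rdP.
Qed.

(** * A limit that is not layerwise computable *)

Definition asb (P : Prop) : bool := if excluded_middle_informative P then true else false.

Lemma asbP P : reflect P (asb P).
Proof. by rewrite /asb; case: excluded_middle_informative => H; constructor. Qed.

(** Weak König's lemma: the path keeps to strings with extensions in [T] of every length and appends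
    a one whenever that is possible. *)
Lemma weak_konig (T : seq bool -> Prop) :
  (forall s t, T (s ++ t) -> T s) -> (forall m, exists s, size s = m /\ T s) ->
  exists X : cantor, forall n, T (mkseq X n).
Proof.
move=> Tprefix Tinf.
pose ext s := forall m, exists t, size t = m /\ T (s ++ t).
have ext_rcons s : ext s -> ~ ext (rcons s true) -> ext (rcons s false).
  move=> exts /not_all_ex_not [m1 Nm1] m2.
  (* One bit chooses the child and [m1 + m2] more serve either case: after a one, [m1] bits
     contradict the choice of [m1]; after a zero, [m2] bits are what is wanted. *)
  have [[|b t] [] // [sizet] Tt] := exts (m1 + m2).+1; case: b Tt => Tt.
    case: Nm1; exists (take m1 t); split; first by rewrite size_takel ?sizet ?leq_addr.
    by apply: (Tprefix _ (drop m1 t)); rewrite -catA cat_take_drop cat_rcons.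
  exists (take m2 t); split; first by rewrite size_takel ?sizet ?leq_addl.
  by apply: (Tprefix _ (drop m2 t)); rewrite -catA cat_take_drop cat_rcons.
pose next s := asb (ext (rcons s true)).
pose path := fix f n := if n is m.+1 then rcons (f m) (next (f m)) else [::].
exists (fun n => next (path n)) => n.
have -> : mkseq (fun n => next (path n)) n = path n.
  by elim: n => //= n IHn; rewrite mkseqS IHn.
suff /(_ 0) [t [_ Tt]] : ext (path n) by apply: Tprefix Tt.
elim: n => [|n IHn] /=; first by move=> m; have [s] := Tinf m; exists s.
by rewrite /next; case: asbP => // /(ext_rcons _ IHn).
Qed.

(** * Counting strings, and a layer of positive measure *)

Definition strings (m : nat) : seq (seq bool) := map val (enum {: m.-tuple bool}).

Lemma mem_strings m s : (s \in strings m) = (size s == m).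
Proof.
apply/mapP/idP => [[t _ ->]|sm]; first by rewrite size_tuple.
by exists (Tuple sm); rewrite ?mem_enum.
Qed.

Lemma uniq_strings m : uniq (strings m).
Proof. by rewrite map_inj_uniq ?enum_uniq //; apply: val_inj. Qed.

Lemma size_strings m : size (strings m) = 2 ^ m.
Proof. by rewrite size_map -cardE card_tuple card_bool. Qed.

Lemma count_take (p : pred (seq bool)) n m : n <= m ->
  count (p \o take n) (strings m) <= count p (strings n) * 2 ^ (m - n).
Proof.
move=> le_nm; rewrite -!size_filter -(size_strings (m - n)) -(size_allpairs (@cat bool)).
apply: uniq_leq_size; first by rewrite filter_uniq ?uniq_strings.
move=> s; rewrite mem_filter mem_strings => /andP[/= ps /eqP sm].
apply/allpairsP; exists (take n s, drop n s) => /=.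
by rewrite mem_filter ps !mem_strings size_takel ?sm // size_drop sm !eqxx cat_take_drop.
Qed.

(** The union bound, with counting in place of measure. *)
Lemma size_le_cover (T : Type) (p : nat -> pred T) (r : seq nat) (S : seq T) :
  all (fun x => has (p^~ x) r) S -> size S <= \sum_(n <- r) count (p n) S.
Proof.
rewrite all_count => /eqP <-; elim: r => [|n r IHr] /=; first by rewrite big_nil count_pred0.
rewrite big_cons; apply: leq_trans (leq_add (leqnn _) IHr).
by rewrite -count_predUI leq_addr.
Qed.

(* The set C minus U k has positive measure and rd is constantly k on it. Both k = 0 and k = 1
   are needed: as 2^-0 = 1, the set U 0 may have full measure. *)
Lemma positive_layer U : ML_test U -> exists k n0 (C : pred (seq bool)) c,
  (forall s, size s = n0 -> C s -> forall i, i < k -> cyl_sub (U i) s) /\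
  forall m, n0 <= m -> 2 ^ m <= 2 ^ c *
    count (fun s => C (take n0 s) && ~~ asb (cyl_sub (U k) s)) (strings m).
Proof.
move=> [_ _ leU].
have [[c Hc]|N] := classic (exists c, forall m,
  2 ^ m <= 2 ^ c * count (fun s => ~~ asb (cyl_sub (U 0) s)) (strings m)).
  by exists 0, 0, predT, c; split=> // m _; apply: Hc.
(* Otherwise more than three quarters of the strings of some length [n0] have their cylinder inside
   [U 0]; they form [C]. As [U 1] accounts for at most half of the strings, at least a quarter
   remain in [C] outside [U 1], hence the exponent 2. *)
have [n0 Hn0] : exists n0,
    2 ^ 2 * count (fun s => ~~ asb (cyl_sub (U 0) s)) (strings n0) < 2 ^ n0.
  have /not_all_ex_not [n0 /negP] := fun H => N (ex_intro _ 2 H).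
  by rewrite -ltnNge; exists n0.
pose C s := asb (cyl_sub (U 0) s).
exists 1, n0, C, 2; split=> [s _ /asbP sub0 [|]//|m le_m].
have count1 : count (fun s => asb (cyl_sub (U 1) s)) (strings m) * 2 ^ 1 <= 2 ^ m.
  rewrite -size_filter; apply: leU; first by rewrite filter_uniq ?uniq_strings.
    by apply/allP => s; rewrite mem_filter mem_strings => /andP[].
  by move=> s; rewrite mem_filter => /andP[/asbP].
have := count_take (predC C) _ _ le_m.
have E : 2 ^ m = 2 ^ n0 * 2 ^ (m - n0) by rewrite -expnD subnKC.
move=> countC; have {}Hn0 : 2 ^ 2 * count (predC C) (strings n0) < 2 ^ n0 by [].
have : 2 ^ m <= count (fun s => C (take n0 s) && ~~ asb (cyl_sub (U 1) s)) (strings m)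
    + (count (predC C \o take n0) (strings m)
       + count (fun s => asb (cyl_sub (U 1) s)) (strings m)).
  rewrite -{1}(size_strings m) -(count_predT (strings m)).
  elim: (strings m) => //= s S IHS; case: (C _); case: (asb _) => /=; lia.
have : 2 ^ 2 * (count (predC C) (strings n0) * 2 ^ (m - n0)) <= 2 ^ m.
  by rewrite mulnA E leq_mul2r ltnW ?orbT.
lia.
Qed.

(* w passes through the leftmost string of length n + (n + c) above its prefix of length n
   whose cylinder is not contained in V. *)
Definition leftmost (V : cantor -> Prop) (c n : nat) (w : seq bool) : Prop :=
  forall t, size t = n + c -> code_str t < code_str (take (n + c) (drop n w)) ->
    cyl_sub V (take n w ++ t).

(** * A point of the layer outside all leftmost cylinders *)

Section Avoidance.

Variables (V : cantor -> Prop) (c : nat).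

Lemma leftmost_cat n s t : n + (n + c) <= size s ->
  leftmost V c n (s ++ t) <-> leftmost V c n s.
Proof.
move=> le_s; have le_ns : n <= size s by apply: leq_trans le_s; rewrite leq_addr.
rewrite /leftmost takel_cat // drop_cat.
case: ltngtP le_ns => // [lt_ns _|E _].
  by rewrite takel_cat // size_drop leq_subRL // ltnW.
have -> : n + c = 0 by lia.
by rewrite !take0.
Qed.

(* Erasing the forced middle block makes a leftmost string recoverable from n + c fewer bits. *)
Lemma count_leftmost n m : n + (n + c) <= m ->
  count (fun w => ~~ asb (cyl_sub V w) && asb (leftmost V c n w)) (strings m)
    <= 2 ^ (m - (n + c)).
Proof.
move=> le_m; rewrite -size_filter; set S := filter _ _.
pose f w := take n w ++ drop (n + c) (drop n w) : seq bool.
have sizeS w : w \in S -> size w = m by rewrite mem_filter mem_strings => /andP[_ /eqP].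
have f_inj : {in S &, injective f}.
  move=> w w' wS w'S /eqP; rewrite eqseq_cat ?size_takel ?sizeS //; last by lia.
  2: by lia.
  move=> /andP[/eqP Et /eqP Ed].
  have sizeb v : v \in S -> size (take (n + c) (drop n v)) = n + c.
    by move=> vS; rewrite size_takel // size_drop sizeS //; lia.
  have split3 (v : seq bool) : take n v ++ take (n + c) (drop n v) ++ drop (n + c) (drop n v) = v.
    by rewrite !cat_take_drop.
  (* Over the same prefix, a middle block with smaller code would have its cylinder inside [V],
     against the choice of [S]. *)
  have nlt v v' : v \in S -> v' \in S -> take n v = take n v' ->
      ~ code_str (take (n + c) (drop n v)) < code_str (take (n + c) (drop n v')).
    move=> vS v'S E lt_v; have := vS; rewrite mem_filter => /andP[/andP[/asbP Nv _] _].
    have := v'S; rewrite mem_filter => /andP[/andP[_ /asbP Hv'] _].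
    apply: Nv; rewrite -(split3 v) catA => Y /cyl_cat; rewrite E.
    by apply: Hv'; rewrite ?sizeb.
  rewrite -(split3 w) -(split3 w') Et Ed; congr (_ ++ (_ ++ _)).
  apply: code_str_inj; apply/eqP; rewrite eqn_leq.
  by apply/andP; split; rewrite leqNgt; apply/negP; [apply: (nlt w' w) | apply: (nlt w w')].
rewrite -(size_map f); apply: card_strings.
  by rewrite map_inj_in_uniq // filter_uniq ?uniq_strings.
apply/allP => _ /mapP[w /sizeS wm ->].
by rewrite /f size_cat !size_drop size_takel wm; lia.
Qed.

Lemma avoid_leftmost n0 (C : pred (seq bool)) :
  is_open V ->
  (forall m, n0 <= m -> 2 * 2 ^ m <= 2 ^ c *
    count (fun s => C (take n0 s) && ~~ asb (cyl_sub V s)) (strings m)) ->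
  exists X, [/\ C (mkseq X n0), ~ V X
    & forall n, ~ leftmost V c n (mkseq X (n + (n + c)))].
Proof.
move=> openV posC.
(* The guards on the length make [T] closed under prefixes. *)
pose T s := [/\ n0 <= size s -> C (take n0 s), ~ cyl_sub V s
  & forall n, n + (n + c) <= size s -> ~ leftmost V c n s].
have Tprefix s t : T (s ++ t) -> T s.
  move=> [CT NV Nl]; split.
  - move=> le_n; move: CT; rewrite takel_cat // size_cat; apply.
    exact: leq_trans le_n (leq_addr _ _).
  - by move=> H; apply: NV => Y /cyl_cat; apply: H.
  - move=> n le_n; rewrite -(leftmost_cat _ _ t) //; apply: Nl.
    by rewrite size_cat; apply: leq_trans le_n (leq_addr _ _).
have Tlong m : n0 <= m -> exists s, size s = m /\ T s.
  move=> le_m; apply: NNPP => NT.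
  pose alive s := C (take n0 s) && ~~ asb (cyl_sub V s).
  pose hit n s := (n + (n + c) <= m) && (alive s && asb (leftmost V c n s)).
  have := posC m le_m; rewrite -/alive -size_filter; set S := filter _ _.
  have cover : all (fun s => has (hit^~ s) (iota 0 m.+1)) S.
    apply/allP => s; rewrite mem_filter mem_strings => /andP[als /eqP sm].
    apply: contra_notT NT => /hasPn Nhit; exists s; split=> //.
    have /andP[Cs /asbP NV] := als; split=> // n; rewrite sm => le_n Hl.
    have /negP[] : ~~ hit n s by apply: Nhit; rewrite mem_iota; lia.
    by rewrite /hit le_n als; apply/asbP.
  have := size_le_cover _ _ _ _ cover; set s1 := size S => le_sum.
  have : 2 ^ c * s1 <= \sum_(n <- iota 0 m.+1) 2 ^ (m - n).
    apply: leq_trans (leq_mul (leqnn (2 ^ c)) le_sum) _.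
    rewrite big_distrr /=; apply: leq_sum => n _.
    have [le_n|lt_n] := leqP (n + (n + c)) m; last first.
      rewrite (eq_count (a2 := pred0)) ?count_pred0 ?muln0 // => s.
      by rewrite /hit leqNgt lt_n.
    have -> : m - n = c + (m - (n + c)) by lia.
    rewrite expnD leq_mul2l; apply/orP; right.
    apply: leq_trans (count_leftmost _ _ le_n); rewrite /S count_filter.
    apply: sub_count => s /= /andP[/andP[_ /andP[/andP[_ ->] ->]]] //.
  (* The geometric sum falls short of [2 * 2 ^ m] by one, which is the contradiction. *)
  have -> : \sum_(n <- iota 0 m.+1) 2 ^ (m - n) = (2 ^ m.+1).-1.
    rewrite -[iota 0 m.+1]/(index_iota 0 m.+1) big_mkord predn_exp mul1n.
    rewrite (reindex_inj rev_ord_inj) /=; apply: eq_bigr => i _; congr (2 ^ _).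
    by have := ltn_ord i; lia.
  by rewrite expnS; have := expn_gt0 2 m; lia.
have [m|X TX] := weak_konig T Tprefix.
  have [s [sm Ts]] := Tlong (maxn n0 m) (leq_maxl _ _).
  exists (take m s); split; first by rewrite size_takel // sm leq_maxr.
  by apply: (Tprefix _ (drop m s)); rewrite cat_take_drop.
exists X; split.
- by have [+ _ _] := TX n0; rewrite size_mkseq take_oversize ?size_mkseq //; apply.
- by move=> /openV [n Hn]; have [_ + _] := TX n; apply.
- by move=> n; have [_ _] := TX (n + (n + c)); apply; rewrite size_mkseq.
Qed.

End Avoidance.

Lemma mkseqD (X : cantor) n m : mkseq X (n + m) = mkseq X n ++ mkseq (sdrop n X) m.
Proof.
rewrite /mkseq iotaD map_cat add0n; congr cat.
by rewrite -[in LHS](addn0 n) iotaDl -map_comp.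
Qed.

(** * The separating set *)

Section NotLayerwise.

Variables (U : nat -> cantor -> Prop) (HU : universal_ML_test U).
Variable R : nat -> nat -> nat -> bool.
Hypothesis enumR : enumerates R U.
Hypothesis monoR : forall t t' i c, t <= t' -> R t i c -> R t' i c.
Variables k c : nat.

Let W (X : cantor) : Prop := exists n, leftmost (U k) c n (mkseq X (n + (n + c))).

(** Left means smaller code. The two conditions on [d] bound the length of the string it codes from
    below and above, so [d] runs over the strings of length [n + c] left of the middle block; adding
    the prefix code to [2 ^ n * d] gives the code of the concatenation. *)
Let leftmost_by (O : nat -> nat) (s n : nat) : bool :=
  all (fun d => [&& 2 ^ (n + c) <= d.+1
      & prefix_code O n + 2 ^ n * d < prefix_code O (n + (n + c))] ==>
    R s k (prefix_code O n + 2 ^ n * d)) (iota 0 (prefix_code O (n + (n + c)))).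

Let leftmost_by_mono O n s s' : s <= s' -> leftmost_by O s n -> leftmost_by O s' n.
Proof.
move=> le_s /allP H; apply/allP => d /H /implyP Hd; apply/implyP => /Hd; exact: monoR.
Qed.

Let leftmost_byP X n : (exists s, leftmost_by (bits X) s n) <->
  leftmost (U k) c n (mkseq X (n + (n + c))).
Proof.
rewrite /leftmost_by /leftmost !prefix_code_bits mkseqD.
set u := mkseq X n; set w := mkseq _ (n + c).
have sizeu : size u = n by rewrite size_mkseq.
have sizew : size w = n + c by rewrite size_mkseq.
rewrite -{2 3}sizeu take_size_cat // drop_size_cat // take_oversize ?sizew //.
rewrite code_str_cat sizeu.
have ltE d : (code_str u + 2 ^ n * d < code_str u + 2 ^ n * code_str w) = (d < code_str w).
  by rewrite ltn_add2l ltn_pmul2l ?expn_gt0.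
split=> [[s /allP Hs] t st lt_t|Hl].
  apply/(enumR.2 k); exists s; have := Hs (code_str t).
  rewrite ltE lt_t andbT mem_iota code_str_cat sizeu => /(_ _)/implyP; apply.
    by rewrite add0n /=; have := expn_gt0 2 n; nia.
  by have /andP[+ _] := code_str_bounds t; rewrite st.
have [||s Hs] := bounded_collection (fun d s =>
  [&& 2 ^ (n + c) <= d.+1 & d < code_str w] ==> R s k (code_str u + 2 ^ n * d))
  (code_str u + 2 ^ n * code_str w).
- by move=> d s s' le_s /implyP H; apply/implyP => /H; apply: monoR.
- move=> d _; case: andP => [[le_d lt_d]|_]; last by exists 0.
  have [t Et] := code_str_surj d; rewrite -{}Et in le_d lt_d *.
  have [|s Hs] := (enumR.2 k (u ++ t)).1; last by exists s; move: Hs; rewrite code_str_cat sizeu.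
  have /andP[le_t lt_t] := code_str_bounds t; have /andP[_ lt_w] := code_str_bounds w.
  have le1 : n + c < (size t).+1 by rewrite -(ltn_exp2l _ _ (ltnSn 1)); apply: leq_ltn_trans lt_t.
  have le2 : size t < (n + c).+1.
    rewrite -(ltn_exp2l _ _ (ltnSn 1)) -{1}sizew; apply: leq_ltn_trans le_t _.
    by apply: leq_ltn_trans lt_w; apply: leqW.
  by apply: Hl => //; lia.
- by exists s; apply/allP => d; rewrite mem_iota ltE => /Hs.
Qed.

(** Nondecreasing in [s], hence with at most one change, from 0 to 1. *)
Let G (O : nat -> nat) (s : nat) : nat := has (leftmost_by O s) (iota 0 s).

Lemma leftmost_weihrauch :
  weihrauch_le (restr_MLR U (fun X => nat_of_bool (asb (W X)))) (rep_MLR U) rep_nat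
    (LAY U) (rep_MLR U) rep_nat.
Proof.
(* The limit is already the value of the function, so the final program copies the second component
   of the pair. *)
have [e He] : computable any_oracle 1 (fun O v => O (nth 0 v 0 + nth 0 v 0).+1).
  by repeat computable_step.
apply: (limit_weihrauch U HU R enumR monoR G _ _ _ _
  (fun X => nat_of_bool (asb (W X))) e).
- rewrite /G; apply: (computable_has _ _ (fun O v n => leftmost_by O (nth 0 v 0) n)).
    rewrite /leftmost_by; apply: (computable_all _ _ (fun O v d =>
      [&& 2 ^ (nth 0 v 0 + c) <= d.+1
      & prefix_code O (nth 0 v 0) + 2 ^ (nth 0 v 0) * d
          < prefix_code O (nth 0 v 0 + (nth 0 v 0 + c))] ==>
      R (nth 0 (behead v) 0) k (prefix_code O (nth 0 v 0) + 2 ^ (nth 0 v 0) * d))).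
      apply: computable_imply.
        by repeat first [apply: computable_prefix_code | computable_step].
      apply: (computable_app3 _ _ (fun _ t i c => R t i c : nat));
        first [exact: enumR.1 | by repeat first [apply: computable_prefix_code | computable_step]].
    by repeat first [apply: computable_prefix_code | computable_step].
  by repeat computable_step.
- move=> X _; case: asbP => [[n /leftmost_byP [s Hs]]|NW]; last first.
    exists 0 => s _; rewrite /G; case: hasP => // -[n _ Hn]; case: NW; exists n.
    by apply/leftmost_byP; exists s.
  exists (maxn n.+1 s) => s'; rewrite geq_max => /andP[lt_n le_s].
  rewrite /G; case: hasP => // -[]; exists n; first by rewrite mem_iota.
  exact: leftmost_by_mono Hs.
- move=> X _; exists (chi (asb (W X))); split=> // n.
  have := He (bpair (bits X) (chi (asb (W X)))) [:: n] I erefl.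
  by rewrite /= /bpair /= addnn odd_double /= uphalf_double.
Qed.

(** Continuity fails at a point [X] of the layer outside [W]. Past the use of the computation on
    [X], the leftmost extension outside [U k] leads to a point [Y] of [W] on the same layer, where
    the program must repeat its answer. *)
Lemma leftmost_not_layerwise n0 (C : pred (seq bool)) :
  (forall s, size s = n0 -> C s -> forall i, i < k -> cyl_sub (U i) s) ->
  (forall m, n0 <= m -> 2 * 2 ^ m <= 2 ^ c *
    count (fun s => C (take n0 s) && ~~ asb (cyl_sub (U k) s)) (strings m)) ->
  ~ exactly_layerwise_computable U rep_nat (fun X => nat_of_bool (asb (W X))).
Proof.
move=> subC posC [e He]; have [[openU _ _] _] := HU.
have rdC Y : C (mkseq Y n0) -> ~ U k Y -> MLR U Y /\ is_rd U Y k.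
  move=> CY NY; split; first by move=> /(_ k).
  split=> // i lt_i; apply: (subC _ _ CY i lt_i); rewrite ?size_mkseq //.
  exact/cyl_mkseq.
have [X [CX NX NWX]] := avoid_leftmost _ _ _ _ (openU k) posC.
have [RX rdX] := rdC X CX NX.
have [q [/(_ 0) run_q /(_ 0)]] := He X k RX rdX.
case: asbP => [[n /NWX]//|_ q0]; rewrite q0 in run_q.
have [N HN] := eval_finite_use _ _ _ _ run_q.
(* [N] keeps the computation unchanged, and [n0] keeps [Y] in [C]. *)
pose n := maxn N n0; pose u := mkseq X n.
have sizeu : size u = n by rewrite size_mkseq.
(* Some extension is not inside [U k], since [X] itself provides one; the least code gives the
   leftmost. *)
have [|d [[t [Et st Nt]] ltd]] := least_nat (fun d =>
    exists t, [/\ code_str t = d, size t = n + c & ~ cyl_sub (U k) (u ++ t)]).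
  exists (code_str (mkseq (sdrop n X) (n + c))), (mkseq (sdrop n X) (n + c)).
  rewrite size_mkseq; split=> // H; apply: NX; apply: H.
  by rewrite /u -mkseqD; apply/cyl_mkseq.
have [Y NcylY] := not_all_ex_not _ _ Nt; have [cylY NY] := imply_to_and _ _ NcylY.
have EY : mkseq Y (n + (n + c)) = u ++ t.
  apply: (@eq_from_nth _ false); first by rewrite size_mkseq size_cat sizeu st.
  by move=> i; rewrite size_mkseq => lt_i; rewrite nth_mkseq // cylY // size_cat sizeu st.
have XY i : i < n -> Y i = X i.
  by move=> lt_i; rewrite cylY ?size_cat ?sizeu ?ltn_addr // nth_cat sizeu lt_i nth_mkseq.
have CY : C (mkseq Y n0).
  suff -> : mkseq Y n0 = mkseq X n0 by [].
  apply/eq_in_map => i; rewrite mem_iota => lt_i; apply: XY; rewrite /n; lia.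
have WY : W Y.
  exists n; rewrite EY /leftmost (take_size_cat _ sizeu) (drop_size_cat _ sizeu).
  rewrite take_oversize ?st // Et => t' st' /ltd Nt'.
  by apply: NNPP => Ncyl; apply: Nt'; exists t'.
have [RY rdY] := rdC Y CY NY.
have [q' [/(_ 0) run_q' /(_ 0)]] := He Y k RY rdY.
case: asbP => // _ q'0; rewrite q'0 in run_q'.
(* At position 0 the number 0 is coded by 1 and the number 1 by 0, so it suffices to carry the run
   on [X] over to [Y]. The odd part of the oracle is [chi k] for both. *)
suff /(eval_det _ _ _ _ _ run_q') : eval (bpair (bits Y) (chi k)) e [:: 0] (chi 0 0) by [].
apply: HN => x lt_x; rewrite /bpair; case: ifP => // _.
by rewrite /bits XY // /n; lia.
Qed.

End NotLayerwise.

Theorem theorem6p5 (U : nat -> cantor -> Prop) (HU : universal_ML_test U) :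
  (forall f : cantor -> cantor,
      exactly_layerwise_computable U rep_cantor f ->
      weihrauch_le (restr_MLR U f) (rep_MLR U) rep_cantor
                   (LAY U) (rep_MLR U) rep_nat)
  /\ (forall f : cantor -> nat,
      exactly_layerwise_computable U rep_nat f ->
      weihrauch_le (restr_MLR U f) (rep_MLR U) rep_nat
                   (LAY U) (rep_MLR U) rep_nat)
  /\ (exists B : cantor -> bool,
      let g := fun X : cantor => nat_of_bool (B X) in
      weihrauch_le (restr_MLR U g) (rep_MLR U) rep_nat
                   (LAY U) (rep_MLR U) rep_nat
      /\ ~ exactly_layerwise_computable U rep_nat g).
Proof.
split; first by move=> f; apply: exactly_layerwise_weihrauch.
split; first by move=> f; apply: exactly_layerwise_weihrauch.
have [[_ ceU _] _] := HU; have [R [enumR monoR]] := ce_enumerated _ ceU.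
have [k [n0 [C [c [subC posC]]]]] := positive_layer U HU.1.
(* Raising [c] by one supplies the factor 2 that the avoidance argument asks for. *)
exists (fun X => asb (exists n, leftmost (U k) c.+1 n (mkseq X (n + (n + c.+1))))).
split; first exact: (leftmost_weihrauch U HU R enumR monoR).
apply: (leftmost_not_layerwise U HU k c.+1 n0 C) => // m le_m.
by rewrite expnS -mulnA leq_mul2l posC.
Qed.
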